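(* The following algebras satisfy the point-exact condition: (1) quantum polynomial algebras of dimension $2$ and of dimension $3$; (2) quantum polynomial algebras of dimension $4$ that satisfy the (G1) condition.
   Context: $\Bbbk$ is an algebraically closed field of characteristic $0$. A graded algebra $A$ is connected graded if $A_0=\Bbbk$ and $A_i=0$ for $i<0$. For graded modules put $M(n)_i=M_{n+i}$ and $\underline{\operatorname{Ext}}^i_A(M,N)=\bigoplus_{n\in\mathbb Z}\operatorname{Ext}^i_{\operatorname{GrMod}A}(M,N(n))$. A noetherian connected graded algebra $A$ is a quantum polynomial algebra of dimension $n$ if: (i) $\operatorname{gldim}A=n<\infty$; (ii) $\underline{\operatorname{Ext}}^i_A(\Bbbk,A)\cong\underline{\operatorname{Ext}}^i_{A^{op}}(\Bbbk,A)$ is $0$ for $i\ne n$ and $\Bbbk(n)$ for $i=n$; (iii) its Hilbert series is $H_A(t)=\sum_i(\dim_\Bbbk A_i)t^i=(1-t)^{-n}$. Quantum polynomial algebras are Koszul (known), where a connected graded algebra $A$ is Koszul if the right module $\Bbbk_A=A/A_{\ge1}$ has a linear resolution, i.e. a graded projective resolution whose $i$-th term is generated in degree $i$. A Koszul algebra is quadratic: $A=T(V)/(R)=\Bbbk\langle x_1,\dots,x_n\rangle/(f_1,\dots,f_r)$, where $V=A_1$ is finite-dimensional with basis $x_1,\dots,x_n$ and $R\subset V^{\otimes2}$ has basis $f_1,\dots,f_r$. Write $f_i=\sum_j x_jf_{ji}=\sum_j g_{ij}x_j$ with $f_{ji},g_{ij}\in V$. The right module $\Bbbk_A$ has a linear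 resolution $P_\bullet$ with $P_i=A(-i)^{\oplus s_i}$ and differentials $d_i:P_i\to P_{i-1}$ given by matrices over $V$ ($s_0=1$, $s_1=n$, $s_2=r$, $d_1=(x_1,\dots,x_n)$, $d_2=(f_{ji})_{j,i}\in\mathbb M_{n\times r}(V)$). The left module ${}_A\Bbbk$ has a linear resolution $Q_\bullet$ with $Q_i=A(-i)^{\oplus s_i}$ and differentials $h_i$ given by matrices over $V$ ($h_1=(x_1,\dots,x_n)^t$, $h_2=(g_{ij})\in\mathbb M_{r\times n}(V)$, with $h_{i+1}h_i=0$ over $A$). For a matrix $M$ over $V$ and $p=(p_1:\cdots:p_n)\in\mathbb P(V^* )=\mathbb P^{n-1}$, $M_p$ is the matrix over $\Bbbk$ (up to scalar) obtained by substituting $x_i\mapsto p_i$. Define $$X_A=\{p:\operatorname{rank}_\Bbbk(d_2)_p<n\},\qquad {}_AX=\{p:\operatorname{rank}_\Bbbk(h_2)_p<n\}.$$ These are independent of choices; the Koszul algebras under consideration are always assumed to have $X_A$ and ${}_AX$ nonempty. $A$ is right point-exact at degree $i\ge1$ if $\operatorname{rank}_\Bbbk(d_i)_p+\operatorname{rank}_\Bbbk(d_{i+1})_p=s_i$ for all $p\in X_A$; left point-exact at degree $i$ if $\operatorname{rank}_\Bbbk(h_i)_p+\operatorname{rank}_\Bbbk(h_{i+1})_p=s_i$ for all $p\in{}_AX$. $A$ satisfies the point-exact condition if it is both right and left point-exact at every degree $i\ge1$. (G1) condition for a quadratic algebra $A=T(V)/(R)$: with $\mathcal V(R)=\{(p,q)\in\mathbb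 P(V^* )\times\mathbb P(V^* ): g(p,q)=0\ \forall g\in R\}$ (where $g=\sum a_{ij}x_i\otimes x_j$ is evaluated as $\sum a_{ij}p_iq_j$), there are a projective variety $E\subset\mathbb P(V^* )$ (a closed subset with reduced structure, possibly reducible) and $\sigma\in\operatorname{Aut}_\Bbbk E$ with $\mathcal V(R)=\{(p,\sigma(p)):p\in E\}$. *)

(* Defs.v *)
From HB Require Import structures.
From mathcomp Require Import all_boot all_order all_algebra.
From mathcomp Require Import mpoly.
From Stdlib Require Import IndefiniteDescription.

Set Implicit Arguments.
Unset Strict Implicit.
Unset Printing Implicit Defensive.

Import Order.TTheory GRing.Theory Num.Theory.
Local Open Scope ring_scope.

(* The opposite algebra. Every notion about modules below is written for left *)
(* modules; right A-modules are left modules over A^c.                        *)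
HB.instance Definition _ (K : fieldType) (A : algType K) :=
  GRing.Lmodule.copy A^c A.

Fact converse_scalerAl (K : fieldType) (A : algType K) (c : K) (u v : A^c) :
  c *: (u * v) = (c *: u : A^c) * v.
Proof. exact: (@scalerAr K A c v u). Qed.
HB.instance Definition _ (K : fieldType) (A : algType K) :=
  GRing.Lmodule_isLalgebra.Build K A^c (@converse_scalerAl K A).

Fact converse_scalerAr (K : fieldType) (A : algType K) (c : K) (u v : A^c) :
  c *: (u * v) = u * (c *: v : A^c).
Proof. exact: (@scalerAl K A c v u). Qed.
HB.instance Definition _ (K : fieldType) (A : algType K) :=
  GRing.Lalgebra_isAlgebra.Build K A^c (@converse_scalerAr K A).

(** * Subspaces given by predicates *)

Definition is_basis (K : fieldType) (V : lmodType K) (S : V -> Prop)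
    (d : nat) (b : 'I_d -> V) : Prop :=
  (forall j, S (b j)) /\
  (forall v, S v -> exists! c : 'rV[K]_d, v = \sum_j c 0 j *: b j).

Definition has_dim (K : fieldType) (V : lmodType K) (S : V -> Prop) (d : nat) :=
  exists b : 'I_d -> V, is_basis S b.

(** * Graded algebras and graded modules *)

Record is_grading (M : zmodType) (G : int -> M -> Prop) : Prop := IsGrading {
  grading0 : forall i, G i 0;
  gradingB : forall i x y, G i x -> G i y -> G i (x - y);
  grading_sum : forall x, exists (s : seq int) (c : int -> M),
    [/\ uniq s, forall i, G i (c i) & x = \sum_(i <- s) c i];
  grading_direct : forall (s : seq int) (c : int -> M), uniq s ->
    (forall i, G i (c i)) -> \sum_(i <- s) c i = 0 ->
    forall i, i \in s -> c i = 0
}.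

(* Since A_0 = K and A_0 A_i <= A_i, the A_i are automatically K-subspaces.   *)
Record cgAlg (K : fieldType) := CgAlg {
  cg_sort :> algType K;
  cg_deg : int -> cg_sort -> Prop;
  cg_grading : is_grading cg_deg;
  cg_mul : forall i j a b, cg_deg i a -> cg_deg j b -> cg_deg (i + j) (a * b);
  cg_deg0 : forall a, cg_deg 0 a <-> exists c : K, a = c%:A;
  cg_neg : forall i a, i < 0 -> cg_deg i a -> a = 0
}.

Section Opposite.
Variables (K : fieldType) (A : cgAlg K).

Fact op_mul i j (a b : A^c) :
  cg_deg (c := A) i a -> cg_deg (c := A) j b -> cg_deg (c := A) (i + j) (a * b).
Proof. by move=> Ha Hb; rewrite addrC; apply: cg_mul. Qed.

Definition op : cgAlg K :=
  @CgAlg K (A^c : algType K) (@cg_deg K A) (cg_grading A) op_mul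
    (@cg_deg0 K A) (@cg_neg K A).
End Opposite.

Record grMod (K : fieldType) (A : cgAlg K) := GrMod {
  gm_sort :> lmodType A;
  gm_deg : int -> gm_sort -> Prop;
  gm_grading : is_grading gm_deg;
  gm_scale : forall i j (a : A) x,
    cg_deg i a -> gm_deg j x -> gm_deg (i + j) (a *: x)
}.

Definition gr_regular (K : fieldType) (A : cgAlg K) : grMod A :=
  @GrMod K A (A^o : lmodType A) (@cg_deg K A) (cg_grading A) (@cg_mul K A).

(** * The trivial module K = A / A_{>= 1} *)

Section Trivial.
Variables (K : fieldType) (A : cgAlg K).
Implicit Types a b : A.

(* The ideal A_{>= 1}. *)
Definition augid a : Prop :=
  exists t : seq A, (forall y, y \in t -> exists2 j : int, 0 < j & cg_deg j y) /\
    a = \sum_(y <- t) y.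

Let degN i a : cg_deg i a -> cg_deg i (- a).
Proof.
have [g0 gB _ _] := cg_grading A.
by move=> Ha; rewrite -sub0r; apply: gB.
Qed.

Let degD i a b : cg_deg i a -> cg_deg i b -> cg_deg i (a + b).
Proof.
have [g0 gB _ _] := cg_grading A.
by move=> Ha Hb; rewrite -[b]opprK; apply: gB => //; apply: degN.
Qed.

Let augid0 : augid 0.
Proof. by exists [::]; split=> //; rewrite big_nil. Qed.

Let augidh j a : 0 < j -> cg_deg j a -> augid a.
Proof.
move=> j0 Ha; exists [:: a]; split; last by rewrite big_seq1.
by move=> y; rewrite inE => /eqP->; exists j.
Qed.

Let augidD a b : augid a -> augid b -> augid (a + b).
Proof.
move=> [t [Ht ->]] [u [Hu ->]]; exists (t ++ u); split; last by rewrite big_cat.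
by move=> y; rewrite mem_cat => /orP[/Ht|/Hu].
Qed.

Let augid_sum (I : Type) (r : seq I) (F : I -> A) :
  (forall i, augid (F i)) -> augid (\sum_(i <- r) F i).
Proof. by move=> HF; elim/big_ind: _ => // *; apply: augidD. Qed.

Let augidN a : augid a -> augid (- a).
Proof.
move=> [t [Ht ->]]; exists (map -%R t); split; last by rewrite big_map sumrN.
move=> y /mapP[z /Ht [j j0 Hz] ->]; exists j => //; exact: degN.
Qed.

Let augidM a b : augid a -> augid (a * b) /\ augid (b * a).
Proof.
have [g0 gB gS _] := cg_grading A.
move=> [t [Ht ->]]; have [s [c [_ Hc ->]]] := gS b.
have key (y : A) i : y \in t -> augid (y * c i) /\ augid (c i * y).
  move=> /Ht [j j0 Hy]; have [i0|i0] := ltrP i 0.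
    by rewrite (cg_neg i0 (Hc i)) mulr0 mul0r; split.
  split; first exact: (augidh (ltr_wpDr i0 j0) (cg_mul Hy (Hc i))).
  exact: (augidh (ltr_wpDl i0 j0) (cg_mul (Hc i) Hy)).
rewrite mulr_suml mulr_sumr; split; rewrite big_seq_cond;
  elim/big_ind: _ => //; try exact: augidD; move=> y /andP[yt _].
  by rewrite mulr_sumr; apply: augid_sum => i; case: (key y i yt).
by rewrite mulr_suml; apply: augid_sum => i; case: (key y i yt).
Qed.

Let augid_split a : augid a -> exists (s : seq int) (c : int -> A),
  [/\ uniq s, forall i, i \in s -> 0 < i, forall i, cg_deg i (c i)
    & a = \sum_(i <- s) c i].
Proof.
have [g0 gB gS gd] := cg_grading A.
move=> [t [Ht ->]]; elim: t Ht => [|y t IH] Ht.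
  by exists [::], (fun=> 0); split=> //; rewrite !big_nil.
have [|s [c [us ps Hc def_t]]] := IH.
  by move=> z zt; apply: Ht; rewrite inE zt orbT.
have [j j0 Hy] := Ht y (mem_head _ _).
pose c' i := if i == j then (if j \in s then c i else 0) + y else c i.
have Hc' i : cg_deg i (c' i).
  rewrite /c'; case: eqP => [->|//]; apply: degD => //.
  by case: ifP.
exists (if j \in s then s else j :: s), c'; split=> //.
- by case: ifPn => //= ->.
- by case: ifP => _ i; rewrite ?inE; [apply: ps | move=> /orP[/eqP->|/ps]].
rewrite big_cons def_t; case: ifPn => js.
  rewrite (bigD1_seq j) //= [in RHS](bigD1_seq j) //= /c' eqxx js.
  rewrite addrCA addrA; congr (_ + _).
  by apply: eq_bigr => i /negPf ->.
rewrite big_cons /c' eqxx (negPf js) add0r; congr (_ + _).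
rewrite big_seq [RHS]big_seq; apply: eq_bigr => i si.
by case: eqP => // eij; rewrite -eij si in js.
Qed.

Fact augid_const (c : K) : augid c%:A -> c = 0.
Proof.
have [g0 gB gS gd] := cg_grading A.
move=> /augid_split [s [f [us ps Hf def_c]]].
have s0 : 0 \notin s by apply/negP => /ps; rewrite ltxx.
pose f' i := if i == 0 then - c%:A else f i.
have : f' 0 = 0.
  apply: (gd (0 :: s)); rewrite ?mem_head //= ?s0 //.
    move=> i; rewrite /f'; case: eqP => [->|//].
    by apply: degN; apply/cg_deg0; exists c.
  rewrite big_cons {1}/f' eqxx def_c addrC; apply/eqP; rewrite subr_eq0; apply/eqP.
  rewrite big_seq [RHS]big_seq; apply: eq_bigr => i si.
  by rewrite /f'; case: eqP => // i0; rewrite -i0 si in s0.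
by rewrite /f' eqxx => /eqP; rewrite oppr_eq0 scaler_eq0 oner_eq0 orbF => /eqP.
Qed.

Fact aug_exists a : exists c : K, augid (a - c%:A).
Proof.
have [g0 gB gS gd] := cg_grading A.
have [s [f [us Hf ->]]] := gS a.
have aug_hom i : i != 0 -> augid (f i).
  move=> i0; have [ip|ip] := ltrP 0 i; first exact: (augidh ip (Hf i)).
  by rewrite (@cg_neg _ _ i (f i)) // lt_neqAle i0.
have sumP (r : seq int) : 0 \notin r -> augid (\sum_(i <- r) f i).
  move=> r0; rewrite big_seq; elim/big_ind: _ => // i ri.
  by apply: aug_hom; apply: contraNneq r0 => <-.
have [s0|s0] := boolP (0 \in s); last first.
  by exists 0; rewrite scale0r subr0; apply: sumP.
have /cg_deg0 [c def_c] := Hf 0.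
exists c; rewrite (bigD1_seq 0) //= -def_c addrAC subrr add0r -big_filter.
by apply: sumP; rewrite mem_filter eqxx.
Qed.

(* aug a is the component of a in A_0 = K *)
Definition aug a : K := proj1_sig (constructive_indefinite_description _ (aug_exists a)).

Fact augP a : augid (a - (aug a)%:A).
Proof. by rewrite /aug; case: constructive_indefinite_description. Qed.

Fact aug_unique a (c : K) : augid (a - c%:A) -> aug a = c.
Proof.
move=> Hc; apply/eqP; rewrite -subr_eq0; apply/eqP/augid_const.
have -> : (aug a - c)%:A = (a - c%:A) + (- (a - (aug a)%:A)) :> A.
  by rewrite scalerBl opprB [RHS]addrC addrA subrK.
by apply: augidD => //; apply/augidN/augP.
Qed.

Fact augD a b : aug (a + b) = aug a + aug b.
Proof.
apply: aug_unique; rewrite scalerDl opprD addrACA.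
by apply: augidD; apply: augP.
Qed.

Fact augM a b : aug (a * b) = aug a * aug b.
Proof.
apply: aug_unique.
have -> : a * b - (aug a * aug b)%:A
        = (a - (aug a)%:A) * b + (aug a)%:A * (b - (aug b)%:A).
  rewrite mulrBl mulrBr addrA subrK; congr (_ - _).
  by rewrite -scalerAl mul1r scalerA.
by apply: augidD; [case: (augidM b (augP a)) | case: (augidM (aug a)%:A (augP b))].
Qed.

Fact aug1 : aug 1 = 1.
Proof. by apply: aug_unique; rewrite scale1r subrr. Qed.

Definition triv_sort : Type := K.
HB.instance Definition _ := GRing.Zmodule.copy triv_sort K.

Definition triv_scale a (x : triv_sort) : triv_sort := aug a * (x : K).

Fact triv_scaleA a b x : triv_scale a (triv_scale b x) = triv_scale (a * b) x.
Proof. by rewrite /triv_scale augM mulrA. Qed.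
Fact triv_scale1 : left_id 1 triv_scale.
Proof. by move=> x; rewrite /triv_scale aug1 mul1r. Qed.
Fact triv_scaleDr : right_distributive triv_scale +%R.
Proof. by move=> a x y; rewrite /triv_scale [aug a * _]mulrDr. Qed.
Fact triv_scaleDl x : {morph triv_scale^~ x : a b / a + b}.
Proof. by move=> a b; rewrite /triv_scale augD mulrDl. Qed.
HB.instance Definition _ := GRing.Zmodule_isLmodule.Build A triv_sort
  triv_scaleA triv_scale1 triv_scaleDr triv_scaleDl.

Definition triv_deg (i : int) (x : triv_sort) : Prop := i != 0 -> x = 0.

Fact triv_grading : is_grading triv_deg.
Proof.
split=> //.
- by move=> i x y Hx Hy i0; rewrite Hx // Hy // subr0.
- move=> x; exists [:: 0], (fun i => if i == 0 then x else 0); split=> //.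
    by move=> i; rewrite /triv_deg => /negPf ->.
  by rewrite big_seq1 eqxx.
- move=> s c us Hc sum0 i si.
  have [i0|] := eqVneq i 0; last exact: Hc.
  rewrite -sum0 (bigD1_seq i) //= big1 ?addr0 // => j.
  by rewrite i0; apply: Hc.
Qed.

Fact triv_gscale i j (a : A) (x : triv_sort) :
  cg_deg i a -> triv_deg j x -> triv_deg (i + j) (a *: x).
Proof.
move=> Ha Hx ij0; rewrite [LHS]/(triv_scale a x) /triv_scale.
have [j0|/Hx ->] := eqVneq j 0; last exact: mulr0.
rewrite {}j0 addr0 in ij0; suff -> : aug a = 0 by exact: mul0r.
apply: aug_unique; rewrite scale0r subr0.
have [ip|ip] := ltrP 0 i; first exact: (augidh ip Ha).
by rewrite (@cg_neg _ _ i a) // lt_neqAle ij0.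
Qed.

Definition triv : grMod A := GrMod triv_grading triv_gscale.
End Trivial.

(** * Noetherian rings and global dimension *)

Definition left_noetherian (R : nzRingType) : Prop :=
  forall I : R -> Prop, I 0 -> (forall a b, I a -> I b -> I (a + b)) ->
    (forall a b, I b -> I (a * b)) ->
  exists (m : nat) (g : 'I_m -> R),
    forall b, I b <-> exists c : 'I_m -> R, b = \sum_i c i * g i.

Definition noetherian (R : nzRingType) : Prop :=
  left_noetherian R /\ left_noetherian R^c.

Definition projective (R : nzRingType) (P : lmodType R) : Prop :=
  forall (M N : lmodType R) (g : {linear M -> N}) (f : {linear P -> N}),
    (forall y, exists x, g x = y) ->
  exists h : {linear P -> M}, forall x, g (h x) = f x.

Record resolution (R : nzRingType) (M : lmodType R) := Resolution {
  res_obj :> nat -> lmodType R;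
  res_d : forall i, {linear res_obj i.+1 -> res_obj i};
  res_aug : {linear res_obj 0 -> M};
  res_proj : forall i, projective (res_obj i);
  res_surj : forall y, exists x, res_aug x = y;
  res_exact0 : forall x, res_aug x = 0 <-> exists y, x = res_d 0 y;
  res_exact : forall i x, res_d i x = 0 <-> exists y, x = res_d i.+1 y
}.

Definition pd_le (R : nzRingType) (M : lmodType R) (n : nat) : Prop :=
  exists P : resolution M, forall i, (n < i)%N -> forall x : P i, x = 0.

Definition left_gldim (R : nzRingType) (n : nat) : Prop :=
  (forall M : lmodType R, pd_le M n) /\
  (forall m, (forall M : lmodType R, pd_le M m) -> (n <= m)%N).

(* The two global dimensions of a noetherian ring coincide.                   *)
Definition gldim (R : nzRingType) (n : nat) : Prop :=
  left_gldim R n /\ left_gldim R^c n.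

(** * Ext in the category of graded modules *)

(* f is a morphism M -> N(m) in GrMod A *)
Definition gr_hom (K : fieldType) (A : cgAlg K) (M N : grMod A) (m : int)
    (f : {linear M -> N}) : Prop :=
  forall i x, gm_deg i x -> gm_deg (m + i) (f x).

Definition gr_projective (K : fieldType) (A : cgAlg K) (P : grMod A) : Prop :=
  forall (M N : grMod A) (g : {linear M -> N}) (f : {linear P -> N}),
    gr_hom 0 g -> gr_hom 0 f -> (forall y, exists x, g x = y) ->
  exists2 h : {linear P -> M}, gr_hom 0 h & forall x, g (h x) = f x.

Record gr_resolution (K : fieldType) (A : cgAlg K) (M : grMod A) := GrResolution {
  gres_obj :> nat -> grMod A;
  gres_d : forall i, {linear gres_obj i.+1 -> gres_obj i};
  gres_aug : {linear gres_obj 0 -> M};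
  gres_d_hom : forall i, gr_hom 0 (gres_d i);
  gres_aug_hom : gr_hom 0 gres_aug;
  gres_proj : forall i, gr_projective (gres_obj i);
  gres_surj : forall y, exists x, gres_aug x = y;
  gres_exact0 : forall x, gres_aug x = 0 <-> exists y, x = gres_d 0 y;
  gres_exact : forall i x, gres_d i x = 0 <-> exists y, x = gres_d i.+1 y
}.

Section Ext.
Variables (K : fieldType) (A : cgAlg K) (M N : grMod A) (P : gr_resolution M).

Definition cocycle (m : int) (i : nat) (f : {linear P i -> N}) : Prop :=
  gr_hom m f /\ forall x, f (gres_d P i x) = 0.

Definition coboundary (m : int) (i : nat) : (P i -> N) -> Prop :=
  match i return (P i -> N) -> Prop with
  | 0 => fun f => forall x, f x = 0
  | j.+1 => fun f => exists g : {linear P j -> N},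
      gr_hom m g /\ forall x, f x = g (gres_d P j x)
  end.
End Ext.

(* dim_K Ext^i(M, N(m)) = d; the i-th cohomology of Hom(P, N(m)) does not     *)
(* depend on the projective resolution P.                                     *)
Definition Ext_dim (K : fieldType) (A : cgAlg K) (M N : grMod A)
    (i : nat) (m : int) (d : nat) : Prop :=
  forall P : gr_resolution M, exists b : 'I_d -> {linear P i -> N},
    (forall j, cocycle m (b j)) /\
    (forall f : {linear P i -> N}, cocycle m f ->
      exists! c : 'rV[K]_d,
        coboundary m (fun x => f x - \sum_j (c 0 j)%:A *: b j x)).

(** * Quantum polynomial algebras *)

(* H_A(t) (1 - t)^n = 1 as power series *)
Definition hilbert_qpoly (K : fieldType) (A : cgAlg K) (n : nat) : Prop :=
  exists h : nat -> nat,
    (forall i : nat, has_dim (@cg_deg K A i%:Z) (h i)) /\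
    (forall k : nat,
      \sum_(j < k.+1) ((1 - 'X) ^+ n : {poly int})`_j * (h (k - j)%N)%:Z
      = (k == 0%N)%:Z).

(* Ext(k, A) = 0 outside degree n, and Ext^n(k, A) = k(n), which lives in     *)
(* internal degree -n.                                                        *)
Definition gorenstein (K : fieldType) (A : cgAlg K) (n : nat) : Prop :=
  forall (i : nat) (m : int),
    Ext_dim (triv A) (gr_regular A) i m ((i == n) && (m == - n%:Z)).

Definition quantum_polynomial (K : fieldType) (A : cgAlg K) (n : nat) : Prop :=
  [/\ noetherian A, gldim A n, gorenstein A n /\ gorenstein (op A) n
    & hilbert_qpoly A n].

(** * Linear resolutions and point-exactness *)

(* A matrix over V = A_1 is given by its coefficients on a basis              *)
(* x_1, ..., x_n of V: the family D stands for \sum_k D_k x_k.                *)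
Definition lin_mx (K : fieldType) (n a b : nat) : Type := 'I_n -> 'M[K]_(a, b).

Definition lmx_alg (K : fieldType) (A : algType K) (n : nat) (x : 'I_n -> A)
    (a b : nat) (D : lin_mx K n a b) : 'M[A]_(a, b) :=
  \matrix_(i, j) \sum_k D k i j *: x k.

Definition lmx_at (K : fieldType) (n a b : nat) (D : lin_mx K n a b)
    (p : 'rV[K]_n) : 'M[K]_(a, b) :=
  \sum_k p 0 k *: D k.

Section PointExact.
Variables (K : fieldType) (A : cgAlg K) (n : nat) (x : 'I_n -> A).

(* Here d i and h i are the differentials d_{i+1} : P_{i+1} -> P_i and        *)
(* h_{i+1} : Q_{i+1} -> Q_i. Elements of right free modules are columns and   *)
(* those of left free modules are rows. As s_0 = 1, the augmentation clause   *)
(* says that the cokernel of the first differential is A / A_{>= 1}.          *)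
Record right_linear_resolution (s : nat -> nat)
    (d : forall i, lin_mx K n (s i) (s i.+1)) : Prop := {
  rres_s0 : s 0%N = 1%N;
  rres_aug : forall v : 'cV[A]_(s 0%N),
    (forall i j, augid (v i j)) <-> exists w, v = lmx_alg x (d 0%N) *m w;
  rres_exact : forall i (v : 'cV[A]_(s i.+1)),
    lmx_alg x (d i) *m v = 0 <-> exists w, v = lmx_alg x (d i.+1) *m w
}.

Record left_linear_resolution (s : nat -> nat)
    (h : forall i, lin_mx K n (s i.+1) (s i)) : Prop := {
  lres_s0 : s 0%N = 1%N;
  lres_aug : forall v : 'rV[A]_(s 0%N),
    (forall i j, augid (v i j)) <-> exists w, v = w *m lmx_alg x (h 0%N);
  lres_exact : forall i (v : 'rV[A]_(s i.+1)),
    v *m lmx_alg x (h i) = 0 <-> exists w, v = w *m lmx_alg x (h i.+1)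
}.

(* Membership of p in X_A (resp. {}_A X), from d_2 (resp. h_2). *)
Definition degenerate (a b : nat) (D : lin_mx K n a b) (p : 'rV[K]_n) : Prop :=
  p != 0 /\ (\rank (lmx_at D p) < n)%N.

(* Point-exactness at degree i + 1. Linear resolutions are unique up to       *)
(* constant changes of bases, so the conditions do not depend on the choice.  *)
Definition right_point_exact (i : nat) : Prop :=
  forall s d, @right_linear_resolution s d ->
  forall p, degenerate (d 1%N) p ->
    (\rank (lmx_at (d i) p) + \rank (lmx_at (d i.+1) p) = s i.+1)%N.

Definition left_point_exact (i : nat) : Prop :=
  forall s h, @left_linear_resolution s h ->
  forall p, degenerate (h 1%N) p ->
    (\rank (lmx_at (h i) p) + \rank (lmx_at (h i.+1) p) = s i.+1)%N.

Definition point_exact : Prop :=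
  forall i, right_point_exact i /\ left_point_exact i.

(** * The (G1) condition *)

(* Points of P^{n-1} are nonzero row vectors p, q, identified when they span  *)
(* the same line, (p == q)%MS.                                                *)

(* For A = T(V)/(R) quadratic, R is the kernel of V (x) V -> A_2. *)
Definition relation (g : 'M[K]_n) : Prop :=
  \sum_i \sum_j g i j *: (x i * x j) = 0.

Definition zero_locus (p q : 'rV[K]_n) : Prop :=
  forall g, relation g -> \sum_i \sum_j g i j * p 0 i * q 0 j = 0.

End PointExact.

Definition proj_closed (K : fieldType) (n : nat) (E : 'rV[K]_n -> Prop) : Prop :=
  exists S : {mpoly K[n]} -> Prop,
    (forall F, S F -> exists e : nat, F \is e.-homog) /\
    (forall p, p != 0 -> (E p <-> forall F, S F -> F.@[p 0] = 0)).

(* f : E -> E is a morphism of varieties: locally on E it is given by         *)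
(* homogeneous polynomials of the same degree without common zero.            *)
Definition proj_endo (K : fieldType) (n : nat) (E : 'rV[K]_n -> Prop)
    (f : 'rV[K]_n -> 'rV[K]_n) : Prop :=
  (forall p, p != 0 -> E p -> f p != 0 /\ E (f p)) /\
  (forall p, p != 0 -> E p ->
    exists (e e' : nat) (G : {mpoly K[n]}) (F : 'I_n -> {mpoly K[n]}),
      [/\ G \is e'.-homog, G.@[p 0] != 0, forall j, F j \is e.-homog
        & forall q, q != 0 -> E q -> G.@[q 0] != 0 ->
          (\row_j (F j).@[q 0] == f q)%MS]).

Definition proj_auto (K : fieldType) (n : nat) (E : 'rV[K]_n -> Prop)
    (f : 'rV[K]_n -> 'rV[K]_n) : Prop :=
  proj_endo E f /\ exists2 f' : 'rV[K]_n -> 'rV[K]_n, proj_endo E f' &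
    forall p, p != 0 -> E p -> (f' (f p) == p)%MS /\ (f (f' p) == p)%MS.

Definition G1 (K : fieldType) (A : cgAlg K) (n : nat) (x : 'I_n -> A) : Prop :=
  exists (E : 'rV[K]_n -> Prop) (sigma : 'rV[K]_n -> 'rV[K]_n),
    [/\ proj_closed E, proj_auto E sigma
      & forall p q, p != 0 -> q != 0 ->
          (zero_locus x p q <-> E p /\ (q == sigma p)%MS)].

(* Main.v *)
(* A linear resolution of k over a quantum polynomial algebra A of dimension N  *)
(* has ranks C(N, j) by its Euler characteristic, and by the Gorenstein         *)
(* condition its transpose is a linear resolution of k on the other side.       *)
(* Hence the first and last differentials have rank 1 at every point; this      *)
(* settles N = 2. For N = 4, the kernel of d_2 at p and the left kernel of d_3  *)
(* at p consist of the partners of p in the zero locus of R on its two sides,   *)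
(* and (G1) makes them one-dimensional for the same points p.                   *)
(*                                                                              *)
(* For N = 3 one must exclude that d_2 has rank at most 1 at p. That would give *)
(* a relation v u = 0 between nonzero linear forms. The Koszul complex on the   *)
(* left ideal A u is exact in large degrees since A is noetherian, so the       *)
(* multiplicities of A u and of its complement lann(u) are integers adding up   *)
(* to that of A, which is 1: one of A u, lann(u) has linear growth. If A u has, *)
(* then so has the left ideal of the forms vanishing at a point, hence so has   *)
(* the two-sided ideal that they generate; but its quotient has a single        *)
(* generator of degree 1. Otherwise A v, contained in lann(u), has linear       *)
(* growth, so A v A and v A have, and the first case applies to the opposite    *)
(* algebra.                                                                     *)
From HB Require Import structures.
From mathcomp Require Import all_boot all_order all_algebra zify ring lra.
From mathcomp Require Import mpoly.
From Stdlib Require Import Classical_Prop IndefiniteDescription FunctionalExtensionality.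
Require Import Defs.

Set Implicit Arguments.
Unset Strict Implicit.
Unset Printing Implicit Defensive.

Import Order.TTheory GRing.Theory Num.Theory.
Local Open Scope ring_scope.

(** Point-exactness compares ranks of the differentials at a point, so these ranks are computed.
    Write h_1, ..., h_N for the nonzero differentials of a left linear resolution.

    By the Euler characteristic and the Hilbert series, the ranks of the free modules are binomial
    coefficients ([lres_rank]). By the Gorenstein condition the dual complex is exact except for one
    class in position N and degree 0 ([gorenstein_exactS]), so statements about the start of the
    resolution transfer to its end over [op A]. The entries of h_1 span A_1, and so do those of h_N;
    hence both have rank 1 at every point ([lres_rank0], [lres_rank_last]). What remains are the
    middle ranks at a point p where h_2 drops rank: 2 for N = 3, and 3 and 3 for N = 4.

    For N = 4, the kernel of h_2 at p is the space of partners of p in the zero locus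
    ([zero_locusE], [kernel_lift]), and the left kernel of h_3 at p is the space of partners on the
    other side. Under (G1) each is a line, and one is nonzero exactly when the other is
    ([G1_unique_partners], [rank_unique_partner]).

    For N = 3, rank at most 1 at p leads to an identity D2 e = t u with constant nonzero columns e,
    t and a nonzero linear form u ([koszul3_rank]). This contradicts the growth of A, whose
    components have dimension (k+1)(k+2)/2: either A u or its left annihilator has linear growth
    ([principal_dichotomy]), while linear growth of A u is impossible ([principal_not_small]), and
    the other alternative reduces to it over the opposite algebra ([no_rank_one_column]).

    Right point-exactness is left point-exactness of [op A] ([right_linear_resolution_op]). *)

Section LinearCombination.
Variable R : nzRingType.

Definition lincomb (V : lmodType R) d (b : 'I_d -> V) (c : 'rV[R]_d) : V :=
  \sum_j c 0 j *: b j.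

Fact lincomb_is_linear (V : lmodType R) d (b : 'I_d -> V) : linear (lincomb b).
Proof.
move=> a u v; rewrite /lincomb scaler_sumr -big_split; apply: eq_bigr => j _.
by rewrite !mxE scalerDl scalerA.
Qed.
HB.instance Definition _ (V : lmodType R) d (b : 'I_d -> V) :=
  GRing.isLinear.Build R 'rV[R]_d V _ (lincomb b) (lincomb_is_linear b).

Lemma linear_row (V : lmodType R) d (f : {linear 'rV[R]_d -> V}) c :
  f c = \sum_j c 0 j *: f (delta_mx 0 j).
Proof. by rewrite {1}[c]row_sum_delta linear_sum; apply: eq_bigr => j _; rewrite linearZ. Qed.

End LinearCombination.

(** * Dimensions of subspaces given by predicates *)

Section Dimension.
Variable K : fieldType.
Implicit Types U V W : lmodType K.

Definition subspace V (S : V -> Prop) : Prop :=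
  S 0 /\ forall (a : K) u v, S u -> S v -> S (a *: u + v).

(** An upper bound for the dimension of the span. Only containment is asked, so the bound passes to
    arbitrary subsets and to larger [d], as growth estimates require. *)
Definition covered V (S : V -> Prop) (d : nat) : Prop :=
  exists f : {linear 'rV[K]_d -> V}, forall v, S v -> exists c, v = f c.

Definition dim_eq V (S : V -> Prop) (d : nat) : Prop :=
  exists f : {linear 'rV[K]_d -> V},
    injective f /\ forall v, S v <-> exists c, v = f c.

Lemma subspaceZ V (S : V -> Prop) a u : subspace S -> S u -> S (a *: u).
Proof. by case=> S0 SL Su; rewrite -[_ *: _]addr0; apply: SL. Qed.

Lemma subspaceD V (S : V -> Prop) u v : subspace S -> S u -> S v -> S (u + v).
Proof. by case=> S0 SL Su Sv; rewrite -[u]scale1r; apply: SL. Qed.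

Lemma subspace_sum V (S : V -> Prop) (I : Type) (r : seq I) (F : I -> V) :
  subspace S -> (forall i, S (F i)) -> S (\sum_(i <- r) F i).
Proof.
move=> sS HF; elim/big_ind: _ => //; first by case: sS.
by move=> u v; apply: subspaceD.
Qed.

Lemma dim_eq_subspace V (S : V -> Prop) d : dim_eq S d -> subspace S.
Proof.
case=> f [_ Sf]; split; first by apply/Sf; exists 0; rewrite linear0.
by move=> a u v /Sf[c ->] /Sf[e ->]; apply/Sf; exists (a *: c + e); rewrite linearP.
Qed.

Lemma dim_eq_basis V (S : V -> Prop) d (b : 'I_d -> V) :
  subspace S -> is_basis S b -> dim_eq S d.
Proof.
move=> sS [Sb uS]; exists (lincomb b); split=> [c e ce|v]; last first.
  split=> [/uS[c [-> _]]|[c ->]]; first by exists c.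
  by apply: subspace_sum => // j; apply: subspaceZ.
have /uS[g [_ ug]] : S (lincomb b c).
  by apply: subspace_sum => // j; apply: subspaceZ.
by rewrite -(ug c) // -(ug e).
Qed.

Lemma dim_eq_ext V (S T : V -> Prop) d :
  (forall v, S v <-> T v) -> dim_eq S d -> dim_eq T d.
Proof. by move=> ST [f [fi fS]]; exists f; split=> // v; rewrite -ST. Qed.

Lemma dim_eq_covered V (S : V -> Prop) d : dim_eq S d -> covered S d.
Proof. by case=> f [_ fS]; exists f => v /fS. Qed.

Lemma covered_sub V (S T : V -> Prop) d :
  (forall v, S v -> T v) -> covered T d -> covered S d.
Proof. by move=> ST [f fT]; exists f => v /ST/fT. Qed.

Lemma covered_dim_le V (S : V -> Prop) d e : dim_eq S d -> covered S e -> (d <= e)%N.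
Proof.
move=> [f [fi fS]] [g gS].
have fg j : exists c, f (delta_mx 0 j) = g c.
  by apply: gS; apply/fS; exists (delta_mx 0 j).
have [r rP] := functional_choice _ fg.
pose M := \matrix_(j < d) r j.
have fM c : f c = g (c *m M).
  rewrite linear_row mulmx_sum_row linear_sum; apply: eq_bigr => j _.
  by rewrite linearZ /= rP rowK.
suff /eqP <- : row_free M by apply: rank_leq_col.
rewrite -kermx_eq0; apply/eqP.
apply/row_matrixP=> i; apply: fi; rewrite fM -row_mul mulmx_ker.
by rewrite !row0 !linear0.
Qed.

Lemma dim_eq_le V (S T : V -> Prop) d e :
  (forall v, S v -> T v) -> dim_eq S d -> dim_eq T e -> (d <= e)%N.
Proof.
by move=> ST dS dT; apply: covered_dim_le dS (covered_sub ST (dim_eq_covered dT)).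
Qed.

Lemma dim_eq_uniq V (S : V -> Prop) d e : dim_eq S d -> dim_eq S e -> d = e.
Proof. by move=> H1 H2; apply/eqP; rewrite eqn_leq !(@dim_eq_le V S S). Qed.

Lemma covered_leq V (S : V -> Prop) d e : (d <= e)%N -> covered S d -> covered S e.
Proof.
move=> /subnKC <- [f fS]; exists (f \o lsubmx)%FUN => v /fS[c ->].
by exists (row_mx c 0); rewrite /= row_mxKl.
Qed.

Lemma covered_img V W (g : {linear V -> W}) (S : V -> Prop) d :
  covered S d -> covered (fun w => exists2 v, S v & w = g v) d.
Proof. by case=> f fS; exists (g \o f)%FUN => w [v /fS[c ->] ->]; exists c. Qed.

Lemma covered_add V (S T : V -> Prop) d e : covered S d -> covered T e ->
  covered (fun v => exists a b, [/\ S a, T b & v = a + b]) (d + e).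
Proof.
case=> f fS [g gT]; exists ((f \o lsubmx) \+ (g \o rsubmx))%R.
move=> v [a [b [/fS[c ->] /gT[c' ->] ->]]].
by exists (row_mx c c'); rewrite /= row_mxKl row_mxKr.
Qed.

Lemma covered_line V (v : V) : covered (fun w => exists a : K, w = a *: v) 1.
Proof.
exists (lincomb (fun=> v)) => w [a ->]; exists (a%:M).
by rewrite /= /lincomb big_ord1 mxE eqxx mulr1n.
Qed.

(** Starting from the empty matrix, a vector of [P] outside the row space is appended as long as
    there is one, which is decided classically. The rows stay independent, so at most [d - r] steps
    remain. *)
Lemma subspace_row_space d (P : 'rV[K]_d -> Prop) : subspace P ->
  exists r (M : 'M[K]_(r, d)), row_free M /\ forall v, P v <-> (v <= M)%MS.
Proof.
move=> sP.
have sub r (M : 'M_(r, d)) : (forall i, P (row i M)) -> forall v, (v <= M)%MS -> P v.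
  move=> PM v /submxP[c ->]; rewrite mulmx_sum_row.
  by apply: subspace_sum => // i; apply: subspaceZ.
suff H k r (M : 'M[K]_(r, d)) : (d - r <= k)%N -> row_free M ->
    (forall i, P (row i M)) ->
    exists r (M : 'M[K]_(r, d)), row_free M /\ forall v, P v <-> (v <= M)%MS.
  apply: (H d 0%N (0 : 'M_(0, d))); rewrite ?subn0 //; first by rewrite -kermx_eq0 flatmx0.
  by case.
elim: k r M => [|k IH] r M dr frM PM;
  have [[v [Pv nv]]|nex] := classic (exists v, P v /\ ~~ (v <= M)%MS);
  try (exists r, M; split=> // v; split; [move=> Pv | exact: sub];
       by apply/negPn/negP => nv; apply: nex; exists v).
- have: row_full M.
    rewrite /row_full eqn_leq rank_leq_col (eqP frM) /=; lia.
  by rewrite -sub1mx => fM; rewrite (submx_trans (submx1 v) fM) in nv.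
have fr1 : row_free (col_mx M v).
  rewrite /row_free -addsmxE; apply/eqP.
  have /eqP : (\rank (M :&: v) = 0)%N.
    apply/eqP; rewrite -leqn0 leqNgt; apply: contra nv => h.
    have rv : (\rank v <= 1)%N by apply: rank_leq_row.
    have : (v <= M :&: v)%MS.
      rewrite -(geq_leqif (mxrank_leqif_sup (capmxSr M v))).
      exact: leq_trans rv h.
    by move/submx_trans; apply; apply: capmxSl.
  rewrite mxrank_eq0 => /eqP cap0.
  rewrite mxrank_disjoint_sum // (eqP frM) rank_rV.
  by case: eqP nv => // ->; rewrite sub0mx.
apply: (IH _ (col_mx M v)) => //.
  have := rank_leq_col (col_mx M v); rewrite (eqP fr1); lia.
move=> i; rewrite -[i]splitK; case: (split i) => j /=.
  by rewrite rowKu.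
by rewrite rowKd row_id.
Qed.

Lemma rank_nullity_ex V W (g : {linear V -> W}) (S : V -> Prop) d : dim_eq S d ->
  exists z r, [/\ dim_eq (fun v => S v /\ g v = 0) z,
    dim_eq (fun w => exists2 v, S v & w = g v) r & (d = z + r)%N].
Proof.
move=> [f [fi fS]].
have [|z [M [frM PM]]] := @subspace_row_space d (fun c => g (f c) = 0).
  by split=> [|a u v /= gu gv]; rewrite ?linear0 // !linearP gu gv scaler0 addr0.
(* The rows of [M] span the kernel of [g] composed with [f]; a complement [N] of it is mapped
   bijectively onto the image. *)
pose N := row_base (M^C)%MS.
have MN : (M :&: N)%MS = 0 by apply/eqP; rewrite -submx0 -(capmx_compl M) capmxS ?eq_row_base.
exists z, (\rank (M^C)%MS); split.
- exists (f \o mulmxr M)%FUN; split=> [c e /= /fi|v]; first exact: row_free_inj.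
  split=> [[/fS[c ->] /PM/submxP[e ->]]|[e ->]]; first by exists e.
  by split; [apply/fS; exists (e *m M) | apply/PM/submxMl].
- exists (g \o (f \o mulmxr N))%FUN; split=> [c e /= /eqP|w].
    rewrite -subr_eq0 -!linearB /= -mulmxBl => /eqP/PM le_M.
    have: ((c - e) *m N <= M :&: N)%MS by rewrite sub_capmx le_M submxMl.
    rewrite MN submx0 mulmx_free_eq0 ?subr_eq0; first by move/eqP.
    exact: row_base_free.
  split=> [[v /fS[c ->] ->]|[e ->]]; last by exists (f (e *m N)) => //; apply/fS; exists (e *m N).
  have: (c <= M + N)%MS.
    rewrite (adds_eqmx (eqmx_refl M) (eq_row_base _)).
    by rewrite submx_full ?addsmx_compl_full.
  case/sub_addsmxP => -[c1 c2] /= ->; exists c2; rewrite !linearD /=.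
  by rewrite (_ : g (f (c1 *m M)) = 0) ?add0r //; apply/PM/submxMl.
- by rewrite mxrank_compl (eqP frM) subnKC // -(eqP frM) rank_leq_col.
Qed.

Lemma rank_nullity V W (g : {linear V -> W}) (S : V -> Prop) (T : W -> Prop) d z r :
  dim_eq S d -> dim_eq (fun v => S v /\ g v = 0) z ->
  dim_eq T r -> (forall w, T w <-> exists2 v, S v & w = g v) -> (d = z + r)%N.
Proof.
move=> /(rank_nullity_ex g)[z' [r' [dz dr ->]]] dz' dr' TS.
rewrite (dim_eq_uniq dz dz'); congr addn; apply: dim_eq_uniq dr _.
exact: dim_eq_ext dr'.
Qed.

Lemma dim_eq0 V : dim_eq (fun v : V => v = 0) 0.
Proof.
exists (lincomb (fun=> 0)); split=> [c e _|v]; first by apply/rowP; case.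
split=> [->|[c ->]]; first by exists 0; rewrite linear0.
by rewrite /= /lincomb big_ord0.
Qed.

Lemma dim_eq_inj V W (g : {linear V -> W}) (S : V -> Prop) d :
  dim_eq S d -> (forall v, S v -> g v = 0 -> v = 0) ->
  dim_eq (fun w => exists2 v, S v & w = g v) d.
Proof.
move=> dS g0; have [z [r [dz dr ->]]] := rank_nullity_ex g dS.
suff -> : z = 0%N by [].
apply: dim_eq_uniq dz _; apply: dim_eq_ext (dim_eq0 V) => v.
by split=> [->|[]]; [split; [case: (dim_eq_subspace dS) | rewrite linear0] | exact: g0].
Qed.

Lemma dim_eq_ffun V (S : V -> Prop) (s d : nat) : dim_eq S d ->
  dim_eq (fun F : {ffun 'I_s -> V} => forall i, S (F i)) (s * d).
Proof.
move=> [f [fi fS]].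
pose g (c : 'rV[K]_(s * d)) : {ffun 'I_s -> V} := [ffun i => f (row i (vec_mx c))].
have gL : linear g by move=> a u v; apply/ffunP=> i; rewrite !ffunE !linearP.
pose gl : {linear _ -> _} := HB.pack g (GRing.isLinear.Build K _ _ _ g gL).
exists gl; split=> [c e /ffunP ce|F].
  apply: (can_inj (@vec_mxK K s d)); apply/row_matrixP=> i; apply: fi.
  by have := ce i; rewrite !ffunE.
split=> [SF|[c ->] i]; last by rewrite ffunE; apply/fS; exists (row i (vec_mx c)).
have [c cP] := functional_choice _ (fun i => proj1 (fS (F i)) (SF i)).
exists (mxvec (\matrix_i c i)); apply/ffunP=> i.
by rewrite ffunE mxvecK rowK.
Qed.

End Dimension.

(** * Homogeneous components *)

Lemma sum_on_subseq (M : zmodType) (s t : seq int) (c : int -> M) :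
  uniq s -> uniq t -> {subset s <= t} ->
  \sum_(i <- t) (if i \in s then c i else 0) = \sum_(i <- s) c i.
Proof.
move=> us ut st; rewrite -big_mkcond -big_filter; apply: perm_big.
apply: uniq_perm => //; first exact: filter_uniq.
by move=> i; rewrite mem_filter; case: (boolP (i \in s)) => // /st.
Qed.

Section Component.
Variables (M : zmodType) (G : int -> M -> Prop) (gG : is_grading G).

Lemma homog0 i : G i 0. Proof. by case: gG. Qed.

Lemma homogB i x y : G i x -> G i y -> G i (x - y).
Proof. by case: gG => _ + _ _; apply. Qed.

Lemma homogN i x : G i x -> G i (- x).
Proof. by rewrite -sub0r; apply: homogB; apply: homog0. Qed.

Lemma homogD i x y : G i x -> G i y -> G i (x + y).
Proof. by move=> Gx Gy; rewrite -[y]opprK; apply/homogB/homogN. Qed.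

Lemma homog_sum i (I : Type) (r : seq I) (P : pred I) (F : I -> M) :
  (forall j, P j -> G i (F j)) -> G i (\sum_(j <- r | P j) F j).
Proof. by move=> GF; elim/big_ind: _ => //; [apply: homog0 | apply: homogD]. Qed.

Definition decomposition x (s : seq int) (c : int -> M) : Prop :=
  [/\ uniq s, forall i, G i (c i) & x = \sum_(i <- s) c i].

Lemma decomposition_uniq x s c s' c' k :
  decomposition x s c -> decomposition x s' c' ->
  (if k \in s then c k else 0) = (if k \in s' then c' k else 0).
Proof.
move=> [us Gc def_x] [us' Gc' def_x']; case: gG => _ _ _ gd.
pose t := undup (s ++ s').
pose f i := (if i \in s then c i else 0) - (if i \in s' then c' i else 0).
have [kt|] := boolP (k \in t); last first.
  by rewrite mem_undup mem_cat negb_or => /andP[/negPf-> /negPf->].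
apply/eqP; rewrite -subr_eq0; apply/eqP.
apply: (gd t f) kt; first exact: undup_uniq.
  by move=> i; apply: homogB; case: ifP => _ //; apply: homog0.
rewrite sumrB !sum_on_subseq ?undup_uniq //; first by rewrite -def_x -def_x' subrr.
  by move=> i si; rewrite mem_undup mem_cat si orbT.
by move=> i si; rewrite mem_undup mem_cat si.
Qed.

(** The component is characterized through all decompositions at once, which determines it and lets
    a description operator turn it into a function. *)
Fact comp_exists k x : exists y, forall s c, decomposition x s c ->
  y = if k \in s then c k else 0.
Proof.
case: gG => _ _ /(_ x)[s [c dx]] _.
exists (if k \in s then c k else 0) => s' c' dx'; exact: decomposition_uniq dx dx'.
Qed.

Definition comp k x : M :=
  proj1_sig (constructive_indefinite_description _ (comp_exists k x)).

Lemma compE k x s c : decomposition x s c -> comp k x = if k \in s then c k else 0.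
Proof. by rewrite /comp; case: constructive_indefinite_description => y /= +; apply. Qed.

Lemma comp_support x : exists s, uniq s /\ forall t, uniq t -> {subset s <= t} ->
  x = \sum_(k <- t) comp k x.
Proof.
case: gG => _ _ /(_ x)[s [c dx]] _; exists s.
case: (dx) => us _ def_x; split=> // t ut st.
under eq_bigr do rewrite (compE _ dx).
by rewrite sum_on_subseq.
Qed.

Lemma comp_homog k x : G k (comp k x).
Proof.
case: gG => _ _ /(_ x)[s [c dx]] _; rewrite (compE _ dx); case: ifP => _.
  by case: dx.
exact: homog0.
Qed.

Lemma comp_id k x : G k x -> comp k x = x.
Proof.
move=> Gx; rewrite (@compE k x [:: k] (fun i => if i == k then x else 0)).
  by rewrite mem_head eqxx.
split=> //; last by rewrite big_seq1 eqxx.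
by move=> i; case: eqP => [->|_] //; apply: homog0.
Qed.

Lemma comp_other k l x : G l x -> k != l -> comp k x = 0.
Proof.
move=> Gx kl; rewrite (@compE k x [:: l] (fun i => if i == l then x else 0)).
  by rewrite inE (negPf kl).
split=> //; last by rewrite big_seq1 eqxx.
by move=> i; case: eqP => [->|_] //; apply: homog0.
Qed.

Fact comp_is_additive k : zmod_morphism (comp k).
Proof.
move=> x y; case: gG => _ _ gS _.
have [s [c dx]] := gS x; have [s' [c' dy]] := gS y.
pose t := undup (s ++ s').
rewrite (compE _ dx) (compE _ dy) (@compE k (x - y) t
  (fun i => (if i \in s then c i else 0) - (if i \in s' then c' i else 0))).
  case: ifP => //; rewrite mem_undup mem_cat => /norP[/negPf-> /negPf->].
  by rewrite subrr.
case: dx dy => us Gc def_x [us' Gc' def_y]; split; first exact: undup_uniq.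
  by move=> i; apply: homogB; case: ifP => _ //; apply: homog0.
rewrite sumrB !sum_on_subseq ?undup_uniq -?def_x -?def_y //.
  by move=> i si; rewrite mem_undup mem_cat si orbT.
by move=> i si; rewrite mem_undup mem_cat si.
Qed.
HB.instance Definition _ k :=
  GRing.isZmodMorphism.Build M M (comp k) (@comp_is_additive k).

Lemma comp_support_seq (xs : seq M) : exists s, uniq s /\
  forall t, uniq t -> {subset s <= t} -> forall x, x \in xs ->
    x = \sum_(k <- t) comp k x.
Proof.
elim: xs => [|y xs [s [us sP]]]; first by exists [::].
have [s' [us' s'P]] := comp_support y.
exists (undup (s ++ s')); split=> [|t ut st x]; first exact: undup_uniq.
rewrite inE => /orP[/eqP->|xxs].
  by apply: s'P => // k ks; apply: st; rewrite mem_undup mem_cat ks orbT.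
by apply: sP => // k ks; apply: st; rewrite mem_undup mem_cat ks.
Qed.

End Component.

(** * Homogeneous components of products *)

Section GradedAlgebra.
Variables (K : fieldType) (A : cgAlg K).
Implicit Types a b : A.
Local Notation deg := (@cg_deg K A).
Local Notation gA := (cg_grading A).
Local Notation pi := (comp (cg_grading A)).

Lemma deg1 : deg 0 1.
Proof. by apply/cg_deg0; exists 1; rewrite scale1r. Qed.

Lemma deg_alg (c : K) : deg 0 c%:A.
Proof. by apply/cg_deg0; exists c. Qed.

Lemma degZ k (c : K) a : deg k a -> deg k (c *: a).
Proof. by move=> Ha; rewrite -mulr_algl -[k]add0r; apply: cg_mul => //; apply: deg_alg. Qed.

Lemma deg_subspace k : subspace (deg k).
Proof.
split=> [|c u v Hu Hv]; first exact: homog0 gA k.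
by apply: (homogD gA) => //; apply: degZ.
Qed.

Lemma compMr k l a b : deg l b -> pi (k + l) (a * b) = pi k a * b.
Proof.
move=> Hb; have [s [us sP]] := comp_support gA a.
rewrite [in LHS](sP s) // mulr_suml raddf_sum /=.
have e i : pi (k + l) (pi i a * b) = if i == k then pi i a * b else 0.
  have H : deg (i + l) (pi i a * b) by apply: cg_mul => //; apply: comp_homog.
  case: eqP => [<-|/eqP ik]; first by rewrite (comp_id gA).
  by rewrite (comp_other gA H) // (inj_eq (addIr l)) eq_sym.
under eq_bigr do rewrite e.
rewrite -big_mkcond; have [ks|ks] := boolP (k \in s).
  by rewrite -big_filter filter_pred1_uniq // big_seq1.
rewrite big_seq_cond big1; last by move=> i /andP[si /eqP ik]; rewrite -ik si in ks.
have -> : pi k a = 0; last by rewrite mul0r.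
rewrite {1}(sP s) // raddf_sum big_seq big1 //= => i si.
rewrite (comp_other gA (comp_homog gA i a)) //.
by apply: contraNneq ks => ->.
Qed.

Lemma compMl k l a b : deg l b -> pi (l + k) (b * a) = b * pi k a.
Proof.
move=> Hb; have [s [us sP]] := comp_support gA a.
rewrite [in LHS](sP s) // mulr_sumr raddf_sum /=.
have e i : pi (l + k) (b * pi i a) = if i == k then b * pi i a else 0.
  have H : deg (l + i) (b * pi i a) by apply: cg_mul => //; apply: comp_homog.
  case: eqP => [<-|/eqP ik]; first by rewrite (comp_id gA).
  by rewrite (comp_other gA H) // (inj_eq (addrI l)) eq_sym.
under eq_bigr do rewrite e.
rewrite -big_mkcond; have [ks|ks] := boolP (k \in s).
  by rewrite -big_filter filter_pred1_uniq // big_seq1.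
rewrite big_seq_cond big1; last by move=> i /andP[si /eqP ik]; rewrite -ik si in ks.
have -> : pi k a = 0; last by rewrite mulr0.
rewrite {1}(sP s) // raddf_sum big_seq big1 //= => i si.
rewrite (comp_other gA (comp_homog gA i a)) //.
by apply: contraNneq ks => ->.
Qed.

Lemma aug_homog k a : 0 < k -> deg k a -> augid a.
Proof.
move=> k0 Ha; exists [:: a]; split; last by rewrite big_seq1.
by move=> y; rewrite inE => /eqP->; exists k.
Qed.

Lemma augid_aug a : augid a <-> aug a = 0.
Proof.
split=> [Ha|a0]; last by have := augP a; rewrite a0 scale0r subr0.
by apply: aug_unique; rewrite scale0r subr0.
Qed.

End GradedAlgebra.

Arguments deg_alg {K} A c.

Definition homog_mx (K : fieldType) (A : cgAlg K) (m n : nat) (k : int) (v : 'M[A]_(m, n)) : Prop :=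
  forall i j, cg_deg k (v i j).

Section HomogeneousMatrices.
Variables (K : fieldType) (A : cgAlg K).
Local Notation gA := (cg_grading A).

Definition comp_mx m n k (v : 'M[A]_(m, n)) : 'M[A]_(m, n) := map_mx (comp gA k) v.

Lemma comp_mx_homog m n k (v : 'M[A]_(m, n)) : homog_mx k (comp_mx k v).
Proof. by move=> i j; rewrite mxE; apply: comp_homog. Qed.

Lemma comp_mx_id m n k (v : 'M[A]_(m, n)) : homog_mx k v -> comp_mx k v = v.
Proof. by move=> Hv; apply/matrixP=> i j; rewrite mxE comp_id. Qed.

Lemma comp_mxMr m n p k l (v : 'M[A]_(m, n)) (w : 'M[A]_(n, p)) :
  homog_mx l w -> comp_mx (k + l) (v *m w) = comp_mx k v *m w.
Proof.
move=> Hw; apply/matrixP=> i j; rewrite !mxE raddf_sum; apply: eq_bigr => h _.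
by rewrite !mxE /= compMr.
Qed.

Lemma homogM m n p k l (v : 'M[A]_(m, n)) (w : 'M[A]_(n, p)) :
  homog_mx k v -> homog_mx l w -> homog_mx (k + l) (v *m w).
Proof.
by move=> Hv Hw i j; rewrite mxE; apply: (homog_sum gA) => h _; apply: cg_mul.
Qed.

Lemma homog_mx0 m n k : homog_mx k (0 : 'M[A]_(m, n)).
Proof. by move=> i j; rewrite mxE; apply: homog0 gA k. Qed.

Lemma homog_mxB m n k (v w : 'M[A]_(m, n)) : homog_mx k v -> homog_mx k w -> homog_mx k (v - w).
Proof. by move=> Hv Hw i j; rewrite !mxE; apply: (homogB gA). Qed.

Lemma homog_neg m n k (v : 'M[A]_(m, n)) : k < 0 -> homog_mx k v -> v = 0.
Proof. by move=> k0 Hv; apply/matrixP=> i j; rewrite mxE; apply: cg_neg (Hv i j). Qed.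

Lemma homog_deg0 m n (v : 'M[A]_(m, n)) :
  homog_mx 0 v -> exists c : 'M[K]_(m, n), v = map_mx (in_alg A) c.
Proof.
move=> Hv.
have /functional_choice[f fP] : forall ij : 'I_m * 'I_n, exists c : K, v ij.1 ij.2 = c%:A.
  by move=> [i j]; apply/cg_deg0/Hv.
by exists (\matrix_(i, j) f (i, j)); apply/matrixP=> i j; rewrite !mxE; exact: (fP (i, j)).
Qed.

Lemma homog_const m n (c : 'M[K]_(m, n)) : homog_mx (A := A) 0 (map_mx (in_alg A) c).
Proof. by move=> i j; rewrite mxE; apply: deg_alg. Qed.

Lemma homog_lmx n (x : 'I_n -> A) a b (D : lin_mx K n a b) :
  (forall i, cg_deg 1 (x i)) -> homog_mx 1 (lmx_alg x D).
Proof.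
by move=> Hx i j; rewrite mxE; apply: (homog_sum gA) => k _; apply: degZ.
Qed.

End HomogeneousMatrices.

(** * Gorenstein duality for linear resolutions *)

Section FreeModule.
Variables (K : fieldType) (A : cgAlg K) (s : nat) (i : int).
Local Notation gA := (cg_grading A).

(** This grading makes the free module the shift A(-i)^s, with its basis in degree [i]. *)
Definition free_deg (j : int) (v : 'rV[A]_s) : Prop := homog_mx (j - i) v.

Fact free_grading : is_grading free_deg.
Proof.
split.
- by move=> j; apply: homog_mx0.
- by move=> j u v; apply: homog_mxB.
- move=> v; have [t [ut tP]] := comp_support_seq gA [seq v 0 l | l <- enum 'I_s].
  exists [seq k + i | k <- t], (fun j => comp_mx (j - i) v); split.
  + by rewrite map_inj_uniq //; apply: addIr.
  + by move=> j; apply: comp_mx_homog.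
  apply/rowP=> l; rewrite summxE big_map.
  rewrite [LHS](tP t ut _ (v 0 l)) //; last by apply: map_f; rewrite mem_enum.
  by apply: eq_bigr => k _; rewrite mxE addrK.
- move=> t c ut Gc sum0 j jt; apply/rowP=> l; rewrite mxE.
  have [_ _ _ gd] := gA.
  have := gd [seq k - i | k <- t] (fun k => c (k + i) 0 l).
  move/(_ _ _ _ (j - i)); rewrite subrK; apply.
  + by rewrite map_inj_uniq //; apply: addIr.
  + by move=> k; have := Gc (k + i) 0 l; rewrite addrK.
  + rewrite big_map; under eq_bigr do rewrite subrK.
    by rewrite -summxE sum0 mxE.
  + exact: map_f.
Qed.

Fact free_scale j k (a : A) (v : 'rV[A]_s) :
  cg_deg j a -> free_deg k v -> free_deg (j + k) (a *: v).
Proof. by move=> Ha Hv h l; rewrite mxE -addrA; apply: cg_mul. Qed.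

Definition free_gr : grMod A := @GrMod K A 'rV[A]_s free_deg free_grading free_scale.

Lemma free_deg_delta l : free_deg i (delta_mx 0 l).
Proof.
by move=> h k; rewrite subrr mxE; case: (_ && _); [exact: deg1 | exact: (homog0 gA)].
Qed.

Lemma free_gr_projective : gr_projective free_gr.
Proof.
move=> M N g f Hg Hf gsurj.
have pre (l : 'I_s) : exists m : M, gm_deg i m /\ g m = f (delta_mx 0 l).
  have [y def_y] := gsurj (f (delta_mx 0 l)).
  (* A preimage of a homogeneous element may be replaced by its component of degree [i], because [g]
     preserves degrees. *)
  exists (comp (gm_grading M) i y); split; first exact: comp_homog.
  have Hf1 : gm_deg i (f (delta_mx 0 l)).
    by have := Hf i (delta_mx 0 l); rewrite add0r; apply; apply: free_deg_delta.
  rewrite -[RHS](comp_id (gm_grading N) Hf1) -def_y.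
  have [t [ut tP]] := comp_support (gm_grading M) y.
  pose t' := undup (i :: t).
  have ut' : uniq t' by apply: undup_uniq.
  have it' : i \in t' by rewrite mem_undup mem_head.
  have -> : g y = \sum_(k <- t') g (comp (gm_grading M) k y).
    rewrite {1}(tP t' ut') ?linear_sum // => k kt.
    by rewrite mem_undup inE kt orbT.
  have Hk k : gm_deg k (g (comp (gm_grading M) k y)).
    by have := Hg k (comp (gm_grading M) k y); rewrite add0r; apply; apply: comp_homog.
  rewrite raddf_sum (bigD1_seq i) //= (comp_id (gm_grading N) (Hk i)) big1 ?addr0 //.
  by move=> k ki; apply: (comp_other (gm_grading N) (Hk k)); rewrite eq_sym.
have [m mP] := functional_choice _ pre.
exists (lincomb m) => [j v Hv|v]; rewrite /= /lincomb.
  apply: (homog_sum (gm_grading M)) => l _.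
  have -> : 0 + j = (j - i) + i by rewrite add0r subrK.
  by apply: gm_scale; [apply: Hv | case: (mP l)].
rewrite linear_sum linear_row; apply: eq_bigr => l _.
by rewrite linearZ; case: (mP l) => _ ->.
Qed.

End FreeModule.

Section Duality.
Variables (K : fieldType) (A : cgAlg K) (n : nat) (x : 'I_n -> A).
Hypothesis x1 : forall i, cg_deg 1 (x i).
Variables (s : nat -> nat) (h : forall i, lin_mx K n (s i.+1) (s i)).
Hypothesis hP : left_linear_resolution x h.
Local Notation gA := (cg_grading A).
Local Notation D i := (lmx_alg x (h i)).

Fact lin_aug_subproof : linear (fun v : 'rV[A]_(s 0) => \sum_j aug (v 0 j) : triv A).
Proof.
move=> a u v.
transitivity (aug a * (\sum_j aug (u 0 j)) + \sum_j aug (v 0 j)); last by [].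
rewrite mulr_sumr -big_split; apply: eq_bigr => j _.
by rewrite !mxE augD augM.
Qed.

Definition lin_aug : {linear 'rV[A]_(s 0) -> triv A} :=
  HB.pack (fun v : 'rV[A]_(s 0) => \sum_j aug (v 0 j) : triv A)
    (GRing.isLinear.Build A 'rV[A]_(s 0) (triv A) _ _ lin_aug_subproof).

Lemma lin_aug_eq0 v : lin_aug v = 0 <-> forall i j, augid (v i j).
Proof.
have uj (j k : 'I_(s 0)) : j = k.
  by apply: val_inj; case: j k => [j +] [k +] /=; rewrite (lres_s0 hP); case: j k => [|?] [|?].
split=> [v0 i j|Hv]; last first.
  by rewrite /lin_aug /= big1 // => j _; apply/augid_aug.
apply/augid_aug; rewrite ord1 -[RHS]v0 /lin_aug /= (bigD1 j) //= big1 ?addr0 //.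
by move=> k; rewrite (uj k j) eqxx.
Qed.

Fact lin_surj y : exists v, lin_aug v = y.
Proof.
have j0 : 'I_(s 0) by rewrite (lres_s0 hP); exact: ord0.
exists ((y : K)%:A *: delta_mx 0 j0).
rewrite /lin_aug /= (bigD1 j0) //= big1 => [|j jj0].
  rewrite !mxE !eqxx mulr1 addr0.
  by apply: aug_unique; exists [::]; rewrite big_nil subrr.
rewrite !mxE eqxx (negPf jj0) mulr0.
by apply/augid_aug; exists [::]; rewrite big_nil.
Qed.

(** Kept transparent: [dual_map] and the exactness lemmas after it rely on its terms unfolding to
    free modules and its differentials to multiplication by matrices. *)
Definition linear_gr_resolution : gr_resolution (triv A).
Proof.
refine (@GrResolution K A (triv A) (fun i => free_gr A (s i) i%:Z)
  (fun i => mulmxr (D i)) lin_aug _ _ _ lin_surj _ _).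
- move=> i j v Hv; rewrite add0r /= /free_deg.
  have -> : j - i%:Z = (j - i.+1%:Z) + 1 by lia.
  by apply: homogM => //; apply: homog_lmx.
- move=> j v Hv; rewrite add0r /= => j0; apply/lin_aug_eq0 => k l.
  have [jp|jn] := ltrP 0 j; first by apply: aug_homog (Hv k l); rewrite subr0.
  have -> : v k l = 0 by apply: cg_neg (Hv k l); rewrite subr0 lt_neqAle j0.
  by exists [::]; rewrite big_nil.
- by move=> i; apply: free_gr_projective.
- by move=> v; rewrite lin_aug_eq0 (lres_aug hP).
- by move=> i v; apply: (lres_exact hP).
Defined.

Fact dual_subproof i (w : 'cV[A]_(s i)) :
  linear (fun v : 'rV[A]_(s i) => (v *m w) 0 0 : A^o).
Proof. by move=> a u v; rewrite mulmxDl -scalemxAl !mxE. Qed.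

(** Maps from a free module of rows to A are pairings with columns; the dual complex thus becomes
    left multiplication by the same matrices on columns. *)
Definition dual_map i (w : 'cV[A]_(s i)) : {linear linear_gr_resolution i -> gr_regular A} :=
  HB.pack (fun v : 'rV[A]_(s i) => (v *m w) 0 0 : A^o)
    (GRing.isLinear.Build A 'rV[A]_(s i) A^o _ _ (dual_subproof w)).

Lemma eq_cV_dual m (u w : 'cV[A]_m) :
  (forall v : 'rV[A]_m, v *m u = v *m w) -> u = w.
Proof. by move=> uw; apply/row_matrixP=> i; rewrite !rowE. Qed.

(** The generators of the [i]-th term lie in degree [i], so a column of degree [k] is a morphism of
    degree [k - i]. The one-dimensional Ext group, in position [N] and degree [-N], therefore
    corresponds to [i = N] and [k = 0]; elsewhere Ext vanishes. *)
Lemma gorenstein_exact N (i : nat) (k : int) (w : 'cV[A]_(s i)) :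
  gorenstein A N -> (i != N) || (k != 0) -> homog_mx k w -> D i *m w = 0 ->
  coboundary (P := linear_gr_resolution) (N := gr_regular A) (k - i%:Z) (dual_map w).
Proof.
move=> gor ik Hw Dw.
have := gor i (k - i%:Z).
have -> : ((i == N) && (k - i%:Z == - N%:Z)) = false.
  apply/negbTE; rewrite negb_and; case/orP: ik => [->//|k0].
  by case: eqP => //= ->; lia.
case/(_ linear_gr_resolution) => b [_ bP].
have [|c [cb _]] := bP (dual_map w).
  split=> [j v Hv|v]; last by rewrite /= -mulmxA Dw mulmx0 mxE.
  have -> : k - i%:Z + j = (j - i%:Z) + k by lia.
  exact: homogM.
rewrite (_ : (dual_map w : linear_gr_resolution i -> gr_regular A) =
  fun v => dual_map w v - \sum_(j < 0) (c 0 j)%:A *: b j v) //.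
by apply: functional_extensionality => v; rewrite big_ord0 subr0.
Qed.

Lemma gorenstein_exact0 N (k : int) (w : 'cV[A]_(s 0)) :
  gorenstein A N -> (0 != N)%N || (k != 0) -> homog_mx k w -> D 0 *m w = 0 -> w = 0.
Proof.
move=> gor ik Hw Dw; have /= w0 := gorenstein_exact gor ik Hw Dw.
apply: eq_cV_dual => v; rewrite mulmx0; apply/matrixP=> i j.
by rewrite !ord1 [LHS]w0 mxE.
Qed.

Lemma gorenstein_exactS N (i : nat) (k : int) (w : 'cV[A]_(s i.+1)) :
  gorenstein A N -> (i.+1 != N) || (k != 0) -> homog_mx k w -> D i.+1 *m w = 0 ->
  exists2 w', homog_mx (k - 1) w' & w = D i *m w'.
Proof.
move=> gor ik Hw Dw; have /= [g [Hg wg]] := gorenstein_exact gor ik Hw Dw.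
exists (\col_l g (delta_mx 0 l)) => [l j|].
  rewrite mxE; have -> : k - 1 = (k - i.+1%:Z) + i%:Z by lia.
  by apply: Hg; apply: free_deg_delta.
apply: eq_cV_dual => v; apply/matrixP=> j l; rewrite !ord1 [LHS]wg.
rewrite mulmxA [LHS](linear_row g) [RHS]mxE.
by apply: eq_bigr => t _; rewrite [(\col_l _) _ _]mxE.
Qed.

End Duality.

(** * Ranks in a linear resolution *)

Section VectorsAsFunctions.
Variables (K : fieldType) (A : cgAlg K).

(** Finite functions with values in A have scalars in K, and dimensions are counted there; matrices
    over A have scalars in A. *)
Definition mulr_ffun m n (D : 'M[A]_(m, n)) (F : {ffun 'I_m -> A}) : {ffun 'I_n -> A} :=
  [ffun l => \sum_i F i * D i l].

Fact mulr_ffun_linear m n (D : 'M[A]_(m, n)) : linear (mulr_ffun D).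
Proof.
move=> c F G; apply/ffunP=> l; rewrite !ffunE scaler_sumr -big_split.
by apply: eq_bigr => i _; rewrite !ffunE mulrDl scalerAl.
Qed.
HB.instance Definition _ m n (D : 'M[A]_(m, n)) :=
  GRing.isLinear.Build K _ _ _ (mulr_ffun D) (mulr_ffun_linear D).

Definition mull_ffun m n (D : 'M[A]_(m, n)) (F : {ffun 'I_n -> A}) : {ffun 'I_m -> A} :=
  [ffun l => \sum_i D l i * F i].

Fact mull_ffun_linear m n (D : 'M[A]_(m, n)) : linear (mull_ffun D).
Proof.
move=> c F G; apply/ffunP=> l; rewrite !ffunE scaler_sumr -big_split.
by apply: eq_bigr => i _; rewrite !ffunE mulrDr scalerAr.
Qed.
HB.instance Definition _ m n (D : 'M[A]_(m, n)) :=
  GRing.isLinear.Build K _ _ _ (mull_ffun D) (mull_ffun_linear D).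

Lemma mulr_ffun_row m n (D : 'M[A]_(m, n)) (F : {ffun 'I_m -> A}) (l : 'I_n) :
  mulr_ffun D F l = ((\row_i F i) *m D) 0 l.
Proof. by rewrite ffunE mxE; apply: eq_bigr => i _; rewrite mxE. Qed.

Lemma mull_ffun_col m n (D : 'M[A]_(m, n)) (F : {ffun 'I_n -> A}) (l : 'I_m) :
  mull_ffun D F l = (D *m (\col_i F i)) l 0.
Proof. by rewrite ffunE mxE; apply: eq_bigr => i _; rewrite mxE. Qed.

Lemma mulr_ffun_eq0 m n (D : 'M[A]_(m, n)) (F : {ffun 'I_m -> A}) :
  mulr_ffun D F = 0 <-> (\row_i F i) *m D = 0.
Proof.
split=> [/ffunP F0|F0]; last by apply/ffunP=> l; rewrite mulr_ffun_row F0 mxE ffunE.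
by apply/rowP=> l; rewrite -mulr_ffun_row F0 mxE ffunE.
Qed.

Lemma mull_ffun_eq0 m n (D : 'M[A]_(m, n)) (F : {ffun 'I_n -> A}) :
  mull_ffun D F = 0 <-> D *m (\col_i F i) = 0.
Proof.
split=> [/ffunP F0|F0]; last by apply/ffunP=> l; rewrite mull_ffun_col F0 mxE ffunE.
by apply/colP=> l; rewrite -mull_ffun_col F0 mxE ffunE.
Qed.

End VectorsAsFunctions.

Section LinearResolution.
Variables (K : fieldType) (A : cgAlg K) (n : nat) (x : 'I_n -> A).
Hypothesis x1 : forall i, cg_deg 1 (x i).
Variables (s : nat -> nat) (h : forall i, lin_mx K n (s i.+1) (s i)).
Hypothesis hP : left_linear_resolution x h.
Local Notation gA := (cg_grading A).
Local Notation D i := (lmx_alg x (h i)).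

Lemma lres_aug_homog k (v : 'rV[A]_(s 0)) : homog_mx k v -> 0 < k ->
  exists2 w, homog_mx (k - 1) w & v = w *m D 0.
Proof.
move=> Hv k0; have [|w def_v] := proj1 (lres_aug hP v).
  by move=> i j; apply: aug_homog (Hv i j).
exists (comp_mx (k - 1) w); first exact: comp_mx_homog.
by rewrite -(comp_mxMr _ _ (homog_lmx (h 0) x1)) subrK -def_v comp_mx_id.
Qed.

Lemma lres_exact_homog i k (v : 'rV[A]_(s i.+1)) : homog_mx k v -> v *m D i = 0 ->
  exists2 w, homog_mx (k - 1) w & v = w *m D i.+1.
Proof.
move=> Hv /(lres_exact hP)[w def_v].
exists (comp_mx (k - 1) w); first exact: comp_mx_homog.
by rewrite -(comp_mxMr _ _ (homog_lmx (h i.+1) x1)) subrK -def_v comp_mx_id.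
Qed.

Lemma lres_complex i : D i.+1 *m D i = 0.
Proof.
apply/row_matrixP=> j; rewrite row_mul row0; apply/(lres_exact hP).
by exists (delta_mx 0 j); rewrite rowE.
Qed.

Variable a : nat -> nat.
Hypothesis aP : forall i : nat, has_dim (@cg_deg K A i%:Z) (a i).

Definition hilb (k : int) : nat := if k is Posz i then a i else 0.

Lemma deg_dim k : dim_eq (@cg_deg K A k) (hilb k).
Proof.
case: k => k /=; first by have [b Hb] := aP k; apply: dim_eq_basis Hb; apply: deg_subspace.
apply: dim_eq_ext (dim_eq0 A) => v; split=> [->|]; first exact: homog0 gA _.
exact: cg_neg.
Qed.

Lemma hilb0 : a 0 = 1%N.
Proof.
apply: (dim_eq_uniq (deg_dim 0)); exists (lincomb (fun _ : 'I_1 => (1 : A))).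
split=> [c e|v].
  rewrite /= /lincomb !big_ord1 => /eqP; rewrite -subr_eq0 -scalerBl scaler_eq0.
  rewrite oner_eq0 orbF subr_eq0 => /eqP ce.
  by apply/rowP=> i; rewrite ord1.
split=> [/cg_deg0[c ->]|[c ->]].
  by exists c%:M; rewrite /= /lincomb big_ord1 mxE eqxx.
by rewrite /= /lincomb big_ord1; apply: deg_alg.
Qed.

Definition lres_piece (m : int) j (F : {ffun 'I_(s j) -> A}) : Prop :=
  forall i, cg_deg (m - j%:Z) (F i).

(** In position 0 the whole piece is taken: for [m > 0] it is the kernel of the augmentation. *)
Definition lres_cycle (m : int) j : {ffun 'I_(s j) -> A} -> Prop :=
  match j return {ffun 'I_(s j) -> A} -> Prop with
  | 0 => fun F => lres_piece m F
  | j'.+1 => fun F => lres_piece m F /\ mulr_ffun (D j') F = 0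
  end.

Lemma lres_piece_dim m j : dim_eq (@lres_piece m j) (s j * hilb (m - j%:Z)).
Proof. exact: dim_eq_ffun (deg_dim _). Qed.

Lemma lres_cycle_dim m j : exists z, dim_eq (@lres_cycle m j) z.
Proof.
case: j => [|j]; first by exists (s 0 * hilb (m - 0%:Z))%N; apply: lres_piece_dim.
have [z [r [dz _ _]]] := rank_nullity_ex (mulr_ffun (D j)) (lres_piece_dim m j.+1).
by exists z.
Qed.

Lemma lres_boundary m j (F : {ffun 'I_(s j) -> A}) : 0 < m ->
  lres_cycle m F <-> exists2 G, lres_piece m G & F = mulr_ffun (D j) G.
Proof.
move=> m0.
have em : m - j%:Z = (m - j.+1%:Z) + 1 by lia.
split=> [cF|[G HG ->]]; last first.
  have HF : lres_piece m (mulr_ffun (D j) G).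
    move=> l; rewrite mulr_ffun_row em; apply: homogM; last exact: homog_lmx.
    by move=> i i'; rewrite mxE; apply: HG.
  case: j G HG HF {F em} => [|j] G HG HF //; split=> //.
  apply/mulr_ffun_eq0.
  have -> : \row_i mulr_ffun (D j.+1) G i = (\row_i G i) *m D j.+1.
    by apply/rowP=> i; rewrite mxE mulr_ffun_row.
  by rewrite -mulmxA lres_complex mulmx0.
have HF : homog_mx (m - j%:Z) (\row_i F i).
  have HF : lres_piece m F by case: j F cF {em} => [|j] F //; case.
  by move=> i l; rewrite mxE; apply: HF.
have [w Hw def_F] : exists2 w, homog_mx (m - j.+1%:Z) w & \row_i F i = w *m D j.
  have -> : m - j.+1%:Z = m - j%:Z - 1 by lia.
  case: j F cF em HF => [|j] F cF em HF; first by apply: lres_aug_homog => //; lia.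
  by apply: lres_exact_homog => //; apply/mulr_ffun_eq0; case: cF.
exists [ffun i => w 0 i]; first by move=> i; rewrite ffunE; apply: Hw.
apply/ffunP=> l; rewrite mulr_ffun_row.
have -> : \row_i [ffun i => w 0 i] i = w by apply/rowP=> i; rewrite mxE ffunE.
by rewrite -def_F mxE.
Qed.

(** In degree m > 0 let z_j be the dimension of the cycles in position j. Then z_0 = s_0 a_m,
    exactness gives s_{j+1} a_{m-j-1} = z_{j+1} + z_j, and z_m = 0 because A has nothing in degree
    -1. The alternating sum telescopes. *)
Lemma lres_euler (m : nat) :
  \sum_(j < m.+1) (-1) ^+ j * (s j)%:Z * (a (m - j))%:Z = (m == 0%N)%:Z.
Proof.
case: m => [|m]; first by rewrite big_ord1 (lres_s0 hP) hilb0.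
have [z zP] := functional_choice _ (lres_cycle_dim m.+1%:Z).
have z0 : z 0%N = (s 0 * a m.+1)%N.
  by rewrite (dim_eq_uniq (zP 0%N) (lres_piece_dim _ _)) subr0.
have zS j : (s j.+1 * hilb (m.+1%:Z - j.+1%:Z) = z j.+1 + z j)%N.
  apply: (rank_nullity (lres_piece_dim _ _) (zP j.+1) (zP j)) => F.
  exact: lres_boundary.
have zm : z m.+1 = 0%N.
  have := zS m.+1; rewrite (_ : m.+1%:Z - m.+2%:Z = -1) ?muln0; last by lia.
  by case: (z m.+1) => // k; rewrite addnS.
suff H k : (k <= m.+1)%N -> \sum_(j < k.+1) (-1) ^+ j * (s j)%:Z * (a (m.+1 - j))%:Z
    = (-1) ^+ k * (z k)%:Z :> int by rewrite H // zm mulr0.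
elim: k => [|k IH] km; first by rewrite big_ord1 z0 subn0 !expr0 !mul1r PoszM.
rewrite big_ord_recr IH /=; last exact: ltnW.
have := zS k; rewrite subzn //= => zk.
by rewrite -mulrA -PoszM zk PoszD exprS; ring.
Qed.

End LinearResolution.

Section Ranks.
Variables (K : fieldType) (A : cgAlg K) (n N : nat) (x : 'I_n -> A).
Hypothesis x1 : forall i, cg_deg 1 (x i).

Lemma coef_1subX_exp j : ((1 - 'X) ^+ N : {poly int})`_j = (-1) ^+ j * ('C(N, j))%:Z.
Proof.
rewrite exprBn coef_sum.
have E (i : 'I_N.+1) : ((-1) ^+ i * 1 ^+ (N - i) * 'X ^+ i *+ 'C(N, i) : {poly int})`_j
   = if i == j :> nat then (-1) ^+ j * ('C(N, j))%:Z else 0.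
  rewrite expr1n mulr1 coefMn -(rmorphN1 polyC) -rmorphXn coefCM coefXn eq_sym.
  by case: eqP => [->|_]; rewrite ?mulr0 ?mul0rn // mulr1 -mulr_natr natz.
under eq_bigr do rewrite E.
rewrite -big_mkcond; have [jN|Nj] := ltnP j N.+1.
  by rewrite (big_pred1 (Ordinal jN)).
rewrite big1 => [|i /eqP ij]; first by rewrite bin_small // mulr0.
by have := ltn_ord i; rewrite ij ltnNge Nj.
Qed.

(** Both sequences, with signs, are inverse to the Hilbert series of A under convolution; since a_0
    = 1, the terms before position [j] determine the one at [j]. *)
Lemma lres_rank (s : nat -> nat) (h : forall i, lin_mx K n (s i.+1) (s i)) :
  left_linear_resolution x h -> hilbert_qpoly A N -> forall j, s j = 'C(N, j).
Proof.
move=> hP [a [aP aH]].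
suff H j : (-1) ^+ j * (s j)%:Z = (-1) ^+ j * ('C(N, j))%:Z :> int.
  by move=> j; have /(mulfI (negbT (signr_eq0 _ _))) [] := H j.
elim/ltn_ind: j => j IH.
have := lres_euler x1 hP aP j; rewrite -aH.
under [RHS]eq_bigr do rewrite coef_1subX_exp.
rewrite !big_ord_recr /= subnn (hilb0 aP) !mulr1.
have -> : \sum_(i < j) (-1) ^+ i * (s i)%:Z * (a (j - i)%N)%:Z
        = \sum_(i < j) (-1) ^+ i * ('C(N, i))%:Z * (a (j - i)%N)%:Z :> int.
  by apply: eq_bigr => i _; rewrite IH.
by move/addrI.
Qed.

End Ranks.

(** * Growth of ideals *)

Section Growth.
Variables (K : fieldType) (A : cgAlg K).
Local Notation gA := (cg_grading A).
Local Notation pi := (comp (cg_grading A)).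

Definition linear_growth (S : nat -> A -> Prop) : Prop :=
  exists C, forall k, covered (S k) (C * k.+1).

Definition rmul (u : A) (a : A) : A := a * u.
Fact rmul_linear u : linear (rmul u).
Proof. by move=> c a b; rewrite /rmul mulrDl scalerAl. Qed.
HB.instance Definition _ u := GRing.isLinear.Build K A A _ (rmul u) (rmul_linear u).

Definition two_sided (W : A -> Prop) (z : A) : Prop :=
  exists2 l : seq (A * A * A), forall t, t \in l -> W t.1.2
    & z = \sum_(t <- l) t.1.1 * t.1.2 * t.2.

Lemma two_sided0 W : two_sided W 0.
Proof. by exists [::]; rewrite ?big_nil. Qed.

Lemma two_sidedD W y z : two_sided W y -> two_sided W z -> two_sided W (y + z).
Proof.
move=> [l lW ->] [l' lW' ->]; exists (l ++ l'); last by rewrite big_cat.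
by move=> t; rewrite mem_cat => /orP[/lW|/lW'].
Qed.

Lemma two_sidedM W a z b : two_sided W z -> two_sided W (a * z * b).
Proof.
case=> l lW ->; exists [seq (a * t.1.1, t.1.2, t.2 * b) | t <- l].
  by move=> t /mapP[t' /lW + ->].
rewrite big_map mulr_sumr mulr_suml; apply: eq_bigr => t _.
by rewrite /= !mulrA.
Qed.

Lemma two_sided_gen (W : A -> Prop) a w b : W w -> two_sided W (a * w * b).
Proof.
by move=> Ww; exists [:: (a, w, b)]; rewrite ?big_seq1 // => t; rewrite inE => /eqP->.
Qed.

Lemma two_sided_sum (W : A -> Prop) (I : Type) (r : seq I) (F : I -> A) :
  (forall i, two_sided W (F i)) -> two_sided W (\sum_(i <- r) F i).
Proof. by move=> HF; elim/big_ind: _ => //; [apply: two_sided0 | apply: two_sidedD]. Qed.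

(* z is a left combination of the products w b listed in L as (w, b, deg b). *)
Fixpoint left_comb (d : A -> int -> Prop) (L : seq (A * A * int)) (z : A) : Prop :=
  if L is (w, b, j) :: L' then
    exists2 p, d p j & left_comb d L' (z - p * w * b)
  else z = 0.

Local Notation any := (fun (_ : A) (_ : int) => True).

Lemma left_comb_cat L L' y z :
  left_comb any L y -> left_comb any L' z -> left_comb any (L ++ L') (y + z).
Proof.
elim: L y => [|[[w b] j] L IH] y /=; first by move=> ->; rewrite add0r.
by case=> p _ Hp Hz; exists p => //; rewrite addrAC; apply: IH.
Qed.

Lemma left_combM L a z : left_comb any L z -> left_comb any L (a * z).
Proof.
elim: L z => [|[[w b] j] L IH] z /=; first by move=> ->; rewrite mulr0.
by case=> p _ /IH Hp; exists (a * p) => //; rewrite -!mulrA -mulrBr !mulrA in Hp *.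
Qed.

Definition admissible (W : A -> Prop) (L : seq (A * A * int)) : Prop :=
  forall t, t \in L -> W t.1.1 /\ cg_deg t.2 t.1.2.

Lemma admissible_cat W L L' : admissible W L -> admissible W L' -> admissible W (L ++ L').
Proof. by move=> HL HL' t; rewrite mem_cat => /orP[/HL|/HL']. Qed.

(** The right factors are split into homogeneous components. Their degrees are recorded so that, for
    an element of degree k, the degrees of the left coefficients can be prescribed too
    ([left_comb_comp]). *)
Lemma two_sided_left_comb W z : two_sided W z ->
  exists L, admissible W L /\ left_comb any L z.
Proof.
case=> l; elim: l z => [|[[a w] b] l IH] z lW ->; first by exists [::]; rewrite big_nil.
have [|L [HL cL]] := IH _ _ erefl; first by move=> t tl; apply: lW; rewrite inE tl orbT.
have [s [us sP]] := comp_support gA b.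
exists ([seq (w, pi k b, k) | k <- s] ++ L); split.
  apply: admissible_cat => // t /mapP[k _ ->] /=; split; last exact: comp_homog.
  exact: (lW (a, w, b) (mem_head _ _)).
rewrite big_cons; apply: left_comb_cat cL; rewrite /= [in X in left_comb _ _ X](sP s) //.
rewrite mulr_sumr; elim: s {us sP} => [|k s IHs]; first by rewrite big_nil.
by rewrite big_cons; exists a => //; rewrite addrC addrA addNr add0r.
Qed.

Lemma left_comb_comp W L k z : (forall w, W w -> cg_deg 1 w) -> admissible W L ->
  left_comb any L z -> left_comb (fun p j => cg_deg (k - j - 1) p) L (pi k z).
Proof.
move=> W1; elim: L z => [|[[w b] j] L IH] z HL /=; first by move=> ->; rewrite raddf0.
have [/= /W1 w1 bj] := HL _ (mem_head _ _).
case=> p _ Hp; exists (pi (k - j - 1) p); first exact: comp_homog.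
rewrite -(compMr _ _ w1) subrK -(compMr _ _ bj) subrK -raddfB.
by apply: IH => // t tL; apply: HL; rewrite inE tL orbT.
Qed.

Lemma left_noetherian_gens (I : A -> Prop) : left_noetherian A ->
  I 0 -> (forall a b, I a -> I b -> I (a + b)) -> (forall a b, I b -> I (a * b)) ->
  exists (m : nat) (g : 'I_m -> A), (forall i, I (g i)) /\
    forall b, I b -> exists c : 'I_m -> A, b = \sum_i c i * g i.
Proof.
move=> noeth I0 ID IM; have [m [g gP]] := noeth I I0 ID IM.
exists m, g; split=> [i|b /gP //]; apply/gP; exists (fun j => (j == i)%:R).
rewrite (bigD1 i) //= eqxx mul1r big1 ?addr0 // => j /negPf ->.
exact: mul0r.
Qed.

(* The ideal is finitely generated on the left, so finitely many right factors suffice. *)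
Lemma two_sided_growth (W : A -> Prop) (J : nat -> A -> Prop) : left_noetherian A ->
  (forall w, W w -> cg_deg 1 w) -> linear_growth J ->
  (forall k a w, W w -> cg_deg k%:Z a -> J k (a * w)) ->
  linear_growth (fun k z => cg_deg k%:Z z /\ two_sided W z).
Proof.
move=> noeth W1 [C JC] JW.
have [||a b Hb|m [g [gT gP]]] := @left_noetherian_gens (two_sided W) noeth.
- exact: two_sided0.
- by move=> a b; apply: two_sidedD.
- by rewrite -[a * b]mulr1; apply: two_sidedM.
have [L LP] := functional_choice _ (fun i => two_sided_left_comb (gT i)).
pose LL := flatten [seq L i | i <- enum 'I_m].
have admL : admissible W LL.
  by move=> t /flatten_mapP[i _ ti]; case: (LP i) => HL _; apply: HL.
have combL z : two_sided W z -> left_comb any LL z.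
  move=> /gP[c ->]; rewrite /LL.
  have -> : \sum_i c i * g i = \sum_(i <- enum 'I_m) c i * g i by rewrite big_enum.
  elim: (enum _) => [|i r IH]; first by rewrite big_nil.
  rewrite big_cons /=; apply: left_comb_cat => //; apply: left_combM.
  by case: (LP i).
exists (size LL * C)%N => k.
apply: (@covered_sub _ _ _ (left_comb (fun p j => cg_deg (k%:Z - j - 1) p) LL)).
  by move=> z [Hz /combL cz]; rewrite -(comp_id gA Hz); exact: (left_comb_comp _ W1 admL cz).
elim: (LL) admL => [|[[w b] j] L' IH] HL.
  apply: (@covered_sub _ _ _ (fun z => z = 0)) => //=.
  exact: covered_leq (leq0n _) (dim_eq_covered (dim_eq0 A)).
have [/= Ww bj] := HL _ (mem_head _ _).
have cov1 : covered (fun z => exists2 p, cg_deg (k%:Z - j - 1) p & z = p * w * b) (C * k.+1).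
  have triv : (forall p, cg_deg (k%:Z - j - 1) p -> p * w * b = 0) ->
      covered (fun z => exists2 p, cg_deg (k%:Z - j - 1) p & z = p * w * b) (C * k.+1).
    move=> p0; apply: (@covered_sub _ _ _ (fun z => z = 0)); first by move=> z [p /p0 ? ->].
    exact: covered_leq (leq0n _) (dim_eq_covered (dim_eq0 A)).
  have [jn|j0] := ltrP j 0; first by apply: triv => p _; rewrite (cg_neg jn bj) mulr0.
  case def_i: (k%:Z - j - 1) => [i|i]; last first.
    by rewrite -def_i; apply: triv => p Hp; rewrite (cg_neg _ Hp) ?mul0r // def_i.
  have ik : (C * i.+1 <= C * k.+1)%N by rewrite leq_mul2l; apply/orP; right; lia.
  apply: covered_leq ik _.
  apply: covered_sub (covered_img (rmul b) (JC i)) => z [p Hp ->].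
  by exists (p * w) => //; apply: JW.
rewrite -mulnA mulSn mulnA.
apply: covered_sub (covered_add cov1 (IH _)).
  move=> z [p Hp Hz]; exists (p * w * b), (z - p * w * b); split=> //; first by exists p.
  by rewrite addrC subrK.
by move=> t tL; apply: HL; rewrite inE tL orbT.
Qed.

(* B is finitely generated, so B / A_{>= 1} B is finite-dimensional.            *)
Lemma noetherian_eventually (B J : A -> Prop) : left_noetherian A ->
  B 0 -> (forall a b, B a -> B b -> B (a + b)) -> (forall a b, B b -> B (a * b)) ->
  J 0 -> (forall a b, J a -> J b -> J (a + b)) -> (forall k z, J z -> J (pi k z)) ->
  (forall i a b, 0 < i -> cg_deg i a -> B b -> J (a * b)) ->
  exists k0 : nat, forall (k : nat) b, (k0 <= k)%N -> B b -> cg_deg k%:Z b -> J b.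
Proof.
move=> noeth B0 BD BM J0 JD Jpi JB.
have [m [g [gB gP]]] := left_noetherian_gens noeth B0 BD BM.
have [s [us sP]] := comp_support_seq gA [seq g i | i <- enum 'I_m].
(* [k0] exceeds the degree of every homogeneous component of the generators. *)
have [k0 k0P] : exists k0 : nat, forall j, j \in s -> j < k0%:Z.
  elim: (s) => [|j r [k0 IH]]; first by exists 0%N.
  exists (maxn k0 `|j|%N.+1) => i; rewrite inE => /orP[/eqP->|/IH]; lia.
exists k0 => k b kk Bb Hb; rewrite -(comp_id gA Hb).
have [c def_b] := gP b Bb.
(* The constant terms of the coefficients contribute only in degrees below [k0]; without them the
   coefficients lie in A_{>=1}. *)
have -> : pi k%:Z b = pi k%:Z (\sum_i (c i - (aug (c i))%:A) * g i).
  rewrite def_b; apply/eqP; rewrite -subr_eq0 -raddfB -sumrB; apply/eqP.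
  rewrite raddf_sum big1 //= => i _.
  rewrite -mulrBl opprB addrC subrK mulr_algl.
  have -> : aug (c i) *: g i = aug (c i) *: \sum_(j <- s) pi j (g i).
    by congr (_ *: _); apply: sP => //; apply: map_f; rewrite mem_enum.
  rewrite scaler_sumr raddf_sum big_seq big1 //= => j js.
  apply: (comp_other gA (degZ (aug (c i)) (comp_homog gA j (g i)))).
  by apply: contraTneq (k0P j js) => <-; rewrite -leNgt lez_nat.
apply: Jpi; elim/big_ind: _ => // i _.
have [t [Ht ->]] := augP (c i).
rewrite mulr_suml big_seq; elim/big_ind: _ => // y /Ht[j j0 yj].
exact: JB yj (gB i).
Qed.

End Growth.

(** * Linear forms do not annihilate each other in dimension three *)

(** Newton's forward difference formula from [j0] on, doubled to avoid the fraction i(i-1)/2. *)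
Lemma second_difference_linear (f : nat -> int) (j0 : nat) (e : int) :
  (forall j, (j0 <= j)%N -> f j.+3 - 3 * f j.+2 + 3 * f j.+1 - f j = 0) ->
  f j0.+2 - 2 * f j0.+1 + f j0 = e ->
  forall i : nat, 2 * f (j0 + i)%N
    = 2 * f j0 + 2 * i%:Z * (f j0.+1 - f j0) + e * (i%:Z * (i%:Z - 1)).
Proof.
move=> f3 def_e i.
have d2 j : f (j0 + j).+2 - 2 * f (j0 + j).+1 + f (j0 + j)%N = e.
  elim: j => [|j IH]; first by rewrite addn0.
  have := f3 (j0 + j)%N (leq_addr _ _); rewrite addnS; move: IH; lra.
suff [] : 2 * f (j0 + i)%N = 2 * f j0 + 2 * i%:Z * (f j0.+1 - f j0) + e * (i%:Z * (i%:Z - 1))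
  /\ f (j0 + i).+1 - f (j0 + i)%N = f j0.+1 - f j0 + e * i%:Z by [].
elim: i => [|i [IH1 IH2]]; first by rewrite addn0; split; ring.
have iS : i.+1%:Z = i%:Z + 1 by rewrite -addn1 PoszD.
rewrite addnS; have d2i := d2 i; split; last by rewrite iS mulrDr; lra.
have -> : 2 * f (j0 + i).+1 = 2 * f (j0 + i)%N + 2 * (f (j0 + i).+1 - f (j0 + i)%N) by ring.
by rewrite IH1 IH2 iS; ring.
Qed.

(* The second difference of f is eventually a constant integer, which is 0 or  *)
(* 1 because 0 <= f <= a.                                                      *)
Lemma growth_dichotomy (f g a : nat -> nat) (j0 : nat) :
  (forall k, 2 * a k = k.+1 * k.+2)%N -> (forall k, a k = g k + f k)%N ->
  (forall j, j0 <= j -> f j.+3 + 3 * f j.+1 = 3 * f j.+2 + f j)%N ->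
  (exists C, forall k, f k <= C * k.+1)%N \/ (exists C, forall k, g k <= C * k.+1)%N.
Proof.
move=> a2 agf f3.
pose F k := (f k)%:Z.
have F3 j : (j0 <= j)%N -> F j.+3 - 3 * F j.+2 + 3 * F j.+1 - F j = 0.
  by move=> /f3; rewrite /F; lia.
have := second_difference_linear F3 erefl.
set e := F j0.+2 - _ + _; set d := F j0.+1 - F j0 => Fi.
have F0 k : 0 <= F k by [].
have Fa k : 2 * F k <= (k%:Z + 1) * (k%:Z + 2).
  have : (2 * f k <= 2 * a k)%N by rewrite agf; lia.
  rewrite a2 /F; lia.
have small k : (k < j0)%N -> (a k <= j0.+1 * j0.+2)%N.
  move=> kj; have : (k.+1 * k.+2 <= j0.+1 * j0.+2)%N by apply: leq_mul; lia.
  rewrite -a2; lia.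
have bound (u : nat -> nat) (c1 c2 : nat) : (forall k, u k <= a k)%N ->
    (forall i, u (j0 + i) <= c1 + c2 * i)%N -> exists C, forall k, (u k <= C * k.+1)%N.
  move=> ua ui; exists (j0.+1 * j0.+2 + c1 + c2)%N => k.
  have [kj|jk] := ltnP k j0.
    by apply: leq_trans (ua k) _; apply: leq_trans (small k kj) _; rewrite -addnA mulnDl; nia.
  have := ui (k - j0)%N; rewrite subnKC // => H; apply: leq_trans H _.
  have : (c2 * (k - j0) <= c2 * k)%N by rewrite leq_mul2l leq_subr orbT.
  by rewrite !mulnDl; nia.
have [e0|e0|e0] := ltgtP e 0.
(* For [e < 0] the function [f] would become negative: for this [i], i(i-1) exceeds 2 |d| i + 2 |F
   j0|. *)
- pose i := (2 * `|d| + 2 * `|F j0| + 2)%N.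
  have := F0 (j0 + i)%N; have := Fi i; have : e * (i%:Z * (i%:Z - 1)) <= - (i%:Z * (i%:Z - 1)).
    have : 0 <= i%:Z * (i%:Z - 1) by rewrite /i; nia.
    by move=> i0; rewrite -[leRHS]mulN1r ler_wpM2r //; lia.
  have : d <= `|d|%N%:Z by lia.
  have : F j0 <= `|F j0|%N%:Z by lia.
  rewrite /i; nia.
- have [e1|e2] := leP e 1.
    (* For [e = 1] the quadratic terms of [f] and [a] agree, so they cancel in [g]. *)
    right; have {e0 e1} e1 : e = 1 by lia.
    apply: (@bound g (j0.+1 * j0.+2 + 2 * `|F j0|)%N (2 * j0 + 4 + 2 * `|d|)%N).
      by move=> k; rewrite agf leq_addr.
    move=> i; have := Fi i; rewrite e1 mul1r.
    have := a2 (j0 + i)%N; rewrite agf /F.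
    have : - d * i%:Z <= `|d|%N%:Z * i%:Z by rewrite ler_wpM2r //; lia.
    have : - F j0 <= `|F j0|%N%:Z by lia.
    rewrite /F; nia.
  (* For [e >= 2], expanding the inequality 2f <= 2a at [j0 + i] gives i (i - c) <= q, which fails
     at i = c + q + 1. *)
  pose q : int := (j0%:Z + 1) * (j0%:Z + 2).
  pose c : int := 2 * `|d|%N%:Z + 2 * j0%:Z + 5.
  have [i i_gt] : exists i : nat, i%:Z = c + q + 1.
    by exists (absz (c + q + 1)); rewrite /c /q; nia.
  have q0 : 0 <= q by rewrite /q; nia.
  have c0 : 0 <= c by rewrite /c; lia.
  have i1 : 1 <= i%:Z by lia.
  have h1 : 2 * (i%:Z * (i%:Z - 1)) <= e * (i%:Z * (i%:Z - 1)).
    by rewrite ler_wpM2r ?mulr_ge0 //; lia.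
  have h2 : - d * i%:Z <= `|d|%N%:Z * i%:Z by rewrite ler_wpM2r //; lia.
  have h3 : q + 1 <= i%:Z * (q + 1) by rewrite ler_peMl // addr_ge0.
  have h4 : i%:Z * (i%:Z - c) = i%:Z * (q + 1) by congr (_ * _); lia.
  have := Fa (j0 + i)%N; rewrite (Fi i) PoszD; move: (F0 j0) h1 h2 h3 h4.
  by rewrite /c /q; lra.
left; apply: (@bound f `|F j0|%N `|d|%N).
  by move=> k; rewrite agf leq_addl.
move=> i; have := Fi i; rewrite e0 mul0r addr0.
have : d * i%:Z <= `|d|%N%:Z * i%:Z by rewrite ler_wpM2r //; lia.
rewrite /F; nia.
Qed.

Notation cst A c := (map_mx (in_alg A) c).

(* Acting on columns, D1, D2, D3 resolve k as a right module; acting on rows,  *)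
(* they resolve it as a left module.                                           *)
Record koszul3 (K : fieldType) (A : cgAlg K) (m0 m1 m2 m3 : nat)
    (D1 : 'M[A]_(m0, m1)) (D2 : 'M[A]_(m1, m2)) (D3 : 'M[A]_(m2, m3)) : Prop := {
  k3_deg1 : homog_mx 1 D1;
  k3_deg2 : homog_mx 1 D2;
  k3_deg3 : homog_mx 1 D3;
  k3_D12 : D1 *m D2 = 0;
  k3_D23 : D2 *m D3 = 0;
  k3_col0 : forall k (c : 'cV[A]_m0), homog_mx k c -> 0 < k ->
    exists2 w, homog_mx (k - 1) w & c = D1 *m w;
  k3_col1 : forall k (c : 'cV[A]_m1), homog_mx k c -> D1 *m c = 0 ->
    exists2 w, homog_mx (k - 1) w & c = D2 *m w;
  k3_col2 : forall k (c : 'cV[A]_m2), homog_mx k c -> D2 *m c = 0 ->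
    exists2 w, homog_mx (k - 1) w & c = D3 *m w;
  k3_col3 : forall k (c : 'cV[A]_m3), homog_mx k c -> D3 *m c = 0 -> c = 0;
  k3_row0 : forall k (r : 'rV[A]_m3), homog_mx k r -> 0 < k ->
    exists2 w, homog_mx (k - 1) w & r = w *m D3;
  k3_row1 : forall k (r : 'rV[A]_m2), homog_mx k r -> r *m D3 = 0 ->
    exists2 w, homog_mx (k - 1) w & r = w *m D2;
  k3_row2 : forall k (r : 'rV[A]_m1), homog_mx k r -> r *m D2 = 0 ->
    exists2 w, homog_mx (k - 1) w & r = w *m D1;
  k3_row3 : forall k (r : 'rV[A]_m0), homog_mx k r -> r *m D1 = 0 -> r = 0
}.

(** * Transposition and the opposite algebra *)

Section Opposite.
Variables (K : fieldType) (A : cgAlg K).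

Lemma homog_op m n k (v : 'M[A]_(m, n)) : homog_mx k v -> homog_mx (A := op A) k v^T.
Proof. by move=> Hv i j; rewrite mxE; apply: Hv. Qed.

Lemma homog_opK m n k (v : 'M[op A]_(m, n)) : homog_mx k v -> homog_mx (A := A) k v^T.
Proof. by move=> Hv i j; rewrite mxE; apply: Hv. Qed.

Lemma mulmx_op m n p (u : 'M[A]_(m, n)) (v : 'M[A]_(n, p)) :
  (v^T : 'M[op A]_(p, n)) *m (u^T : 'M[op A]_(n, m)) = (u *m v)^T.
Proof. exact/esym/(trmx_mul_rev (R := A) u v). Qed.

Lemma mulmx_opK m n p (u : 'M[op A]_(m, n)) (v : 'M[op A]_(n, p)) :
  (v^T : 'M[A]_(p, n)) *m (u^T : 'M[A]_(n, m)) = (u *m v)^T.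
Proof. exact/esym/(trmx_mul_rev (R := op A) u v). Qed.

Lemma k3_op m0 m1 m2 m3 (D1 : 'M[A]_(m0, m1)) (D2 : 'M[A]_(m1, m2)) (D3 : 'M[A]_(m2, m3)) :
  koszul3 D1 D2 D3 -> koszul3 (A := op A) D3^T D2^T D1^T.
Proof.
have tr0 m n (c : 'M[A]_(m, n)) : c^T = 0 -> c = 0.
  by move=> c0; rewrite -[c]trmxK c0 trmx0.
case=> H1 H2 H3 D12 D23 c0 c1 c2 c3 r0 r1 r2 r3; split.
- exact: homog_op.
- exact: homog_op.
- exact: homog_op.
- by rewrite mulmx_op D23 trmx0.
- by rewrite mulmx_op D12 trmx0.
- move=> k c /homog_opK/r0 H /H[w /homog_op Hw e]; exists w^T => //.
  by rewrite mulmx_op -e trmxK.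
- move=> k c /homog_opK/r1 H Dc; case: H => [|w /homog_op Hw e].
    by apply: tr0; rewrite -mulmx_op trmxK.
  by exists w^T => //; rewrite mulmx_op -e trmxK.
- move=> k c /homog_opK/r2 H Dc; case: H => [|w /homog_op Hw e].
    by apply: tr0; rewrite -mulmx_op trmxK.
  by exists w^T => //; rewrite mulmx_op -e trmxK.
- move=> k c /homog_opK/r3 H Dc; rewrite -[c]trmxK H ?trmx0 //.
  by apply: tr0; rewrite -mulmx_op trmxK.
- move=> k c /homog_opK/c0 H /H[w /homog_op Hw e]; exists w^T => //.
  by rewrite mulmx_op -e trmxK.
- move=> k c /homog_opK/c1 H Dc; case: H => [|w /homog_op Hw e].
    by apply: tr0; rewrite -mulmx_op trmxK.
  by exists w^T => //; rewrite mulmx_op -e trmxK.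
- move=> k c /homog_opK/c2 H Dc; case: H => [|w /homog_op Hw e].
    by apply: tr0; rewrite -mulmx_op trmxK.
  by exists w^T => //; rewrite mulmx_op -e trmxK.
- move=> k c /homog_opK/c3 H Dc; rewrite -[c]trmxK H ?trmx0 //.
  by apply: tr0; rewrite -mulmx_op trmxK.
Qed.

End Opposite.

Section DotProducts.
Variables (K : fieldType) (A : cgAlg K) (m : nat).

Definition rdot (v : 'cV[A]_m) (F : {ffun 'I_m -> A}) : A := mulr_ffun v F 0.
Fact rdot_linear v : linear (rdot v).
Proof. by move=> c F G; rewrite /rdot linearP !ffunE. Qed.
HB.instance Definition _ v := GRing.isLinear.Build K _ _ _ (rdot v) (rdot_linear v).

Definition ldot (v : 'rV[A]_m) (F : {ffun 'I_m -> A}) : A := mull_ffun v F 0.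
Fact ldot_linear v : linear (ldot v).
Proof. by move=> c F G; rewrite /ldot linearP !ffunE. Qed.
HB.instance Definition _ v := GRing.isLinear.Build K _ _ _ (ldot v) (ldot_linear v).

Lemma rdotE v F : rdot v F = ((\row_i F i) *m v) 0 0.
Proof. exact: mulr_ffun_row. Qed.

Lemma ldotE v F : ldot v F = (v *m (\col_i F i)) 0 0.
Proof. exact: mull_ffun_col. Qed.

Lemma mx11_eq0 (M : 'M[A]_1) : M 0 0 = 0 <-> M = 0.
Proof. by split=> [M0|->]; [apply/matrixP=> i j; rewrite !ord1 M0 mxE | rewrite mxE]. Qed.

Lemma row_ffun (w : 'rV[A]_m) : \row_i [ffun i => w 0 i] i = w.
Proof. by apply/rowP=> i; rewrite mxE ffunE. Qed.

Lemma mulmx_const_mx p (M : 'M[A]_(p, 1)) (b : A) i : (M *m const_mx b : 'M_(p, 1)) i 0 = M i 0 * b.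
Proof. by rewrite mxE big_ord1 [const_mx _ _ _]mxE. Qed.

Lemma const_mx_mulmx p (M : 'M[A]_(1, p)) (b : A) i : (const_mx b *m M : 'M_(1, p)) 0 i = b * M 0 i.
Proof. by rewrite mxE big_ord1 [const_mx _ _ _]mxE. Qed.

Lemma homog_scalar k (a : A) : cg_deg k a -> homog_mx k (const_mx a : 'M[A]_1).
Proof. by move=> Ha i j; rewrite mxE. Qed.

End DotProducts.

(** * A principal left ideal of linear growth is impossible when D2 e = t u *)

Section SmallPrincipalIdeal.
Variables (K : fieldType) (A : cgAlg K) (a : nat -> nat).
Hypothesis aP : forall k : nat, dim_eq (@cg_deg K A k%:Z) (a k).
Hypothesis a2 : (forall k, 2 * a k = k.+1 * k.+2)%N.
Variables (D1 : 'M[A]_(1, 3)) (D2 : 'M[A]_3) (D3 : 'M[A]_(3, 1)).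
Hypothesis k3 : koszul3 D1 D2 D3.
Variables (e t : 'cV[K]_3) (u : A).
Hypothesis D2e : D2 *m cst A e = cst A t *m const_mx u.
Hypothesis e_neq0 : e != 0.
Local Notation gA := (cg_grading A).

Let principal k (z : A) := exists2 b, cg_deg k%:Z b & z = b * u.
Let point_ideal k (z : A) := exists2 w : {ffun 'I_3 -> A},
  (forall i, cg_deg k%:Z (w i)) /\ rdot (cst A e) w = 0 & z = rdot D3 w.

(* Since b.e lies in A u for every syzygy b of D3, A_+ / point_ideal is a      *)
(* shift of A / A u.                                                           *)
Lemma point_ideal_growth : linear_growth principal -> linear_growth point_ideal.
Proof.
case=> C HC; exists (C + 3)%N => -[|k].
  apply: (@covered_sub _ _ _ (@cg_deg K A 1%:Z)).
    move=> z [w [Hw _] ->]; rewrite /= /rdot ffunE; apply: (homog_sum gA) => i _.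
    exact: (cg_mul (Hw i) (k3_deg3 k3 i 0)).
  apply: covered_leq (dim_eq_covered (aP 1)).
  by have := a2 1; lia.
have dP := dim_eq_ffun 3 (aP k.+1).
have [g [r [dG dfP eP]]] := rank_nullity_ex (rdot D3) dP.
have er : r = a k.+2.
  apply: dim_eq_uniq dfP _; apply: dim_eq_ext (aP k.+2) => z; split.
    move=> Hz; have [|w Hw ez] := k3_row0 k3 (homog_scalar Hz); first by [].
    exists [ffun i => w 0 i].
      by move=> i; rewrite ffunE; have := Hw 0 i; rewrite (_ : k.+2%:Z - 1 = k.+1%:Z) //; lia.
    by rewrite /= rdotE row_ffun -ez mxE.
  case=> w Hw -> ; rewrite /= /rdot ffunE; apply: (homog_sum gA) => i _.
  have -> : k.+2%:Z = k.+1%:Z + 1 by lia.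
  exact: (cg_mul (Hw i) (k3_deg3 k3 i 0)).
have [sg [m [dS dm eG]]] := rank_nullity_ex (rdot (cst A e)) dG.
have m_le : (m <= C * k.+1)%N.
  apply: covered_dim_le dm _; apply: covered_sub (HC k) => z [w [Hw Dw] ->].
  have Hr : homog_mx k.+1%:Z (\row_i w i) by move=> i j; rewrite mxE.
  have [|w' Hw' er'] := k3_row1 k3 Hr; first by apply/mx11_eq0; rewrite -rdotE.
  rewrite /= rdotE er' -mulmxA D2e mulmxA.
  exists ((w' *m cst A t) 0 0); last by rewrite mulmx_const_mx.
  have -> : k%:Z = (k.+1%:Z - 1) + 0 by lia.
  by apply: homogM => //; apply: homog_const.
have [q [r' [dQ dr' eQ]]] := rank_nullity_ex (rdot (cst A e)) dP.
have er' : (a k.+1 <= r')%N.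
  apply: dim_eq_le (aP k.+1) dr' => z Hz.
  have [i ei] : exists i, e i 0 != 0.
    apply/existsP; apply: contraNT e_neq0 => /existsPn e0; apply/eqP/colP=> i.
    by rewrite mxE; apply/eqP; have := e0 i; rewrite negbK.
  exists [ffun j => if j == i then (e i 0)^-1 *: z else 0].
    by move=> j; rewrite ffunE; case: eqP => _; [apply: degZ | apply: (homog0 gA)].
  rewrite /= /rdot ffunE (bigD1 i) //= ffunE eqxx big1 ?addr0; last first.
    by move=> j ji; rewrite ffunE (negPf ji) mul0r.
  by rewrite mxE /= mulr_algr scalerA mulfV // scale1r.
have [sg' [i [dS' di eI]]] := rank_nullity_ex (rdot D3) dQ.
have esg : sg' = sg.
  apply: dim_eq_uniq dS' _; apply: dim_eq_ext dS => w.
  by split=> [[[? ?] ?]|[[? ?] ?]].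
apply: (@covered_leq _ _ _ i); last exact: dim_eq_covered di.
(* Combining the four dimension formulas, i = a_{k+2} - r' + m, which is at most a_{k+2} - a_{k+1} +
   m = k + 3 + m. *)
have := a2 k.+1; have := a2 k.+2; subst; nia.
Qed.

Hypothesis noeth : left_noetherian A.

(** Otherwise the left ideal of the forms vanishing at [e] has linear growth, and so has the
    two-sided ideal that its linear forms [W] generate. Modulo that ideal A is generated by a single
    form [y], one normalized to take the value 1 at [e]; so A itself would grow linearly. *)
Lemma principal_not_small : ~ linear_growth principal.
Proof.
move=> /point_ideal_growth small.
pose W w := exists l : 'rV[K]_3, l *m e = 0 /\ w = (cst A l *m D3) 0 0.
have W1 w : W w -> cg_deg 1 w.
  by case=> l [_ ->]; exact: (homogM (homog_const _ _) (k3_deg3 k3)).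
have JW k b w : W w -> cg_deg k%:Z b -> point_ideal k (b * w).
  case=> l [le ->] Hb; exists [ffun i => ((const_mx b : 'M_1) *m cst A l) 0 i].
    split=> [i|].
      rewrite ffunE -[k%:Z]addr0; apply: homogM; last exact: homog_const.
      exact: homog_scalar.
    rewrite /= rdotE row_ffun -mulmxA -map_mxM le.
    by rewrite map_mx0 mulmx0 mxE.
  by rewrite /= rdotE row_ffun -mulmxA const_mx_mulmx.
have [C HC] := two_sided_growth noeth W1 small JW.
have [l le] : exists l : 'rV[K]_3, l *m e = 1.
  have : row_free e^T by rewrite /row_free rank_rV trmx_eq0 e_neq0.
  case/row_freeP=> B eB; exists B^T.
  by rewrite -[e]trmxK -trmx_mul eB trmx1.
pose y := (cst A l *m D3) 0 0.
have y1 : cg_deg 1 y by exact: (homogM (homog_const _ _) (k3_deg3 k3)).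
have D3y i : exists2 v, W v & D3 i 0 = v + e i 0 *: y.
  exists (D3 i 0 - e i 0 *: y); last by rewrite subrK.
  exists (delta_mx 0 i - e i 0 *: l); split.
    rewrite mulmxBl -scalemxAl le -rowE; apply/matrixP=> j j'.
    by rewrite !ord1 !mxE eqxx mulr1 subrr.
  rewrite map_mxB map_mxZ mulmxBl -scalemxAl [in RHS]mxE.
  rewrite map_delta_mx -rowE !mxE /=; congr (_ - _).
  by rewrite mulr_algl /y mxE.
have span k : forall z, cg_deg k%:Z z -> exists (c : K) (v : A),
    two_sided W v /\ z = v + c *: y ^+ k.
  elim: k => [|k IH] z Hz.
    have /cg_deg0[c ->] := Hz; exists c, 0.
    by rewrite expr0 add0r; split=> //; apply: two_sided0.
  have [|w Hw ez] := k3_row0 k3 (homog_scalar Hz); first by [].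
  have {Hw} Hw i : cg_deg k%:Z (w 0 i).
    by have := Hw 0 i; rewrite (_ : k.+1%:Z - 1 = k%:Z) //; lia.
  have /functional_choice[c cP] := fun i => IH _ (Hw i).
  have [v vP] := functional_choice _ cP.
  have {ez} -> : z = \sum_i w 0 i * D3 i 0.
    by have /matrixP/(_ 0 0) := ez; rewrite !mxE.
  exists (\sum_i c i * e i 0), (\sum_i (w 0 i * D3 i 0 - (c i * e i 0) *: y ^+ k.+1)).
  split; last by rewrite sumrB -scaler_suml subrK.
  apply: two_sided_sum => i; have [d Wd ->] := D3y i; have [Tv ew] := vP i.
  have -> : w 0 i * (d + e i 0 *: y) - (c i * e i 0) *: y ^+ k.+1
     = w 0 i * d * 1 + 1 * v i * (e i 0 *: y).
    rewrite mulr1 mul1r mulrDr -addrA; congr (_ + _).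
    have -> : (c i * e i 0) *: y ^+ k.+1 = (c i *: y ^+ k) * (e i 0 *: y).
      by rewrite -scalerAr -scalerAl scalerA mulrC exprSr.
    by rewrite {1}ew mulrDl addrK.
  by apply: two_sidedD; [apply: two_sided_gen | apply: two_sidedM].
have cov k : covered (@cg_deg K A k%:Z) (C * k.+1 + 1).
  apply: covered_sub (covered_add (HC k) (covered_line (y ^+ k))) => z Hz.
  have [c [v [Tv ez]]] := span k z Hz; exists v, (c *: y ^+ k); split=> //; last by exists c.
  split=> //; have -> : v = z - c *: y ^+ k by rewrite ez addrK.
  apply: (homogB gA) => //; apply: degZ.
  elim: (k) => [|j IHj]; first exact: deg1.
  by rewrite exprSr -addn1 PoszD; apply: cg_mul.
(* In degree 2C + 2 the dimension is (2C + 3)(C + 2), above the bound C (2C + 3) + 1. *)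
have := covered_dim_le (aP (2 * C + 2)%N) (cov _); have := a2 (2 * C + 2)%N.
nia.
Qed.

End SmallPrincipalIdeal.

(** * Growth of A u and of the left annihilator of u *)

Section PrincipalIdealDichotomy.
Variables (K : fieldType) (A : cgAlg K) (a : nat -> nat).
Hypothesis aP : forall k : nat, dim_eq (@cg_deg K A k%:Z) (a k).
Hypothesis a2 : (forall k, 2 * a k = k.+1 * k.+2)%N.
Variables (D1 : 'M[A]_(1, 3)) (D2 : 'M[A]_3) (D3 : 'M[A]_(3, 1)).
Hypothesis k3 : koszul3 D1 D2 D3.
Hypothesis noeth : left_noetherian A.
Variable u : A.
Hypothesis u1 : cg_deg 1 u.
Local Notation gA := (cg_grading A).
Local Notation pi := (comp (cg_grading A)).

Let principal k (z : A) := exists2 b, cg_deg k%:Z b & z = b * u.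
Let lann k (z : A) := cg_deg k%:Z z /\ z * u = 0.

Lemma principal_lift (z : A) k : cg_deg k.+1%:Z z -> (exists b, z = b * u) -> principal k z.
Proof.
move=> Hz [b ez]; exists (pi k%:Z b); first exact: comp_homog.
by rewrite -(compMr _ _ u1) -ez comp_id // -PoszD addn1.
Qed.

Lemma principal_deg k z : principal k z -> cg_deg k.+1%:Z z.
Proof. by case=> b Hb ->; rewrite -addn1 PoszD; apply: cg_mul. Qed.

(** Modulo A u these [b] form the socle of A / A u, which is finite-dimensional since A is
    noetherian. Testing the entries of [D3] suffices, as they generate A_{>=1} as a left ideal. *)
Lemma socle_eventually : exists k0 : nat, forall k b, (k0 <= k)%N -> cg_deg k.+1%:Z b ->
  (forall i, exists c, D3 i 0 * b = c * u) -> principal k b.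
Proof.
pose J z := exists c : A, z = c * u.
have JD y z : J y -> J z -> J (y + z).
  by case=> c -> [d ->]; exists (c + d); rewrite mulrDl.
have J0 : J 0 by exists 0; rewrite mul0r.
pose B b := forall i c, 0 < i -> cg_deg i c -> J (c * b).
have [||c b Bb i d i0 Hd|k z [c ->]|i c b i0 Hc Bb|k0 k0P] :=
    noetherian_eventually (B := B) (J := J) noeth _ _ _ J0 JD.
- by move=> i c _ _; rewrite mulr0.
- by move=> b c Bb Bc i d i0 Hd; rewrite mulrDr; apply: JD; [apply: Bb Hd | apply: Bc Hd].
- have [s [us sP]] := comp_support gA c.
  rewrite mulrA (sP s) // mulr_sumr mulr_suml; elim/big_ind: _ => // j _.
  have [j0|j0] := ltrP j 0.
    by rewrite (cg_neg j0 (comp_homog gA j c)) mulr0 mul0r.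
  by apply: (Bb (i + j)); [apply: ltr_wpDr | apply: cg_mul => //; apply: comp_homog].
- by exists (pi (k - 1) c); rewrite -(compMr _ _ u1) subrK.
- exact: Bb Hc.
exists k0 => k b kk Hb Db; apply: principal_lift => //.
apply: (k0P k.+1) => //; first exact: leqW.
move=> i c i0 Hc; have [w _ ec] := k3_row0 k3 (homog_scalar Hc) i0.
have -> : c = \sum_j w 0 j * D3 j 0 by have /matrixP/(_ 0 0) := ec; rewrite !mxE.
rewrite mulr_suml; elim/big_ind: _ => // j _.
by have [d ed] := Db j; exists (w 0 j * d); rewrite -mulrA ed mulrA.
Qed.

(** The left ideal lann(u) is finitely generated, so in large degrees it equals A_{>=1} lann(u); and
    the entries of [D1] generate A_{>=1} as a right ideal. *)
Lemma lann_eventually : exists k0 : nat, forall k b, (k0 <= k)%N -> lann k.+1 b ->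
  exists c : 'cV[A]_3, [/\ homog_mx k%:Z c, forall i, c i 0 * u = 0 & b = (D1 *m c) 0 0].
Proof.
pose B (b : A) := b * u = 0.
pose J z := exists2 c : 'cV[A]_3, forall i, c i 0 * u = 0 & z = (D1 *m c) 0 0.
have [|b c Bb Bc|c b Bb|||k z [c cu ->]|i c b i0 Hc Bb|k0 k0P] :=
  noetherian_eventually (B := B) (J := J) noeth.
- exact: mul0r.
- by rewrite /B mulrDl Bb Bc addr0.
- by rewrite /B -mulrA Bb mulr0.
- by exists 0 => [i|]; rewrite ?mulmx0 mxE ?mul0r.
- move=> y z [c cu ->] [d du ->]; exists (c + d); last by rewrite mulmxDr [in RHS]mxE.
  by move=> i; rewrite mxE mulrDl cu du addr0.
- exists (comp_mx (k - 1) c) => [i|].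
    by rewrite mxE -(compMr _ _ u1) cu raddf0.
  rewrite !mxE raddf_sum; apply: eq_bigr => i _; rewrite mxE /=.
  by rewrite -(compMl _ _ (k3_deg1 k3 0 i)) addrC subrK.
- have [w _ ec] := k3_col0 k3 (homog_scalar Hc) i0.
  exists (w *m const_mx b); first by move=> l; rewrite mulmx_const_mx -mulrA Bb mulr0.
  by rewrite mulmxA mulmx_const_mx -ec mxE.
exists k0 => k b kk [Hb Bb]; have [|c cu eb] := k0P k.+1 b _ Bb Hb; first exact: leqW.
exists (comp_mx k%:Z c); split; first exact: comp_mx_homog.
  by move=> i; rewrite mxE -(compMr _ _ u1) cu raddf0.
rewrite -(comp_id gA Hb) eb !mxE raddf_sum; apply: eq_bigr => i _; rewrite mxE /=.
by rewrite -(compMl _ _ (k3_deg1 k3 0 i)) -PoszD add1n.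
Qed.

(* In large degrees the Koszul complex on A u is exact, so the Hilbert         *)
(* function of A u is eventually a polynomial of degree at most 2 with an      *)
(* integral second difference.                                                 *)
Lemma principal_dichotomy : linear_growth principal \/ linear_growth lann.
Proof.
have /functional_choice[d dP] : forall k, exists d : nat * nat,
    [/\ dim_eq (lann k) d.1, dim_eq (principal k) d.2 & a k = (d.1 + d.2)%N].
  move=> k; have [z [r [dz dr e]]] := rank_nullity_ex (rmul u) (aP k).
  by exists (z, r); split.
have [k1 soc] := socle_eventually; have [k2 ann] := lann_eventually.
(* Let M_k be [principal k], the part of A u in degree k + 1. The recurrence is the Euler
   characteristic of 0 -> M_j -> M_{j+1}^3 -> M_{j+2}^3 -> M_{j+3} -> 0, whose maps are left
   multiplication by [D3], [D2], [D1]. *)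
have rec j : (maxn k1 k2 <= j)%N ->
    ((d j.+3).2 + 3 * (d j.+1).2 = 3 * (d j.+2).2 + (d j).2)%N.
  rewrite geq_max => /andP[j1 j2].
  have dP3 k := dim_eq_ffun 3 (let: And3 _ dk _ := dP k in dk).
  have [z1 [r1 [dz1 dr1 e1]]] := rank_nullity_ex (ldot D1) (dP3 j.+2).
  have [z2 [r2 [dz2 dr2 e2]]] := rank_nullity_ex (mull_ffun D2) (dP3 j.+1).
  have [_ dMj _] := dP j; have [_ dMj3 _] := dP j.+3.
  have ffun_mul (w : 'cV[A]_3) (F : {ffun 'I_3 -> A}) :
      (forall i, F i = w i 0 * u) -> \col_i F i = w *m const_mx u.
    by move=> Fw; apply/colP=> i; rewrite mulmx_const_mx mxE.
  have er1 : r1 = (d j.+3).2.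
    apply: dim_eq_uniq dr1 _; apply: dim_eq_ext dMj3 => z; split.
      case=> b Hb ->; have [|w Hw eb] := k3_col0 k3 (homog_scalar Hb); first by [].
      exists [ffun i => w i 0 * u].
        move=> i; rewrite ffunE; by exists (w i 0) => //; apply: Hw.
      rewrite /= ldotE (@ffun_mul w) => [|i]; last by rewrite ffunE.
      by rewrite mulmxA mulmx_const_mx -eb mxE.
    case=> F HF ->; have /functional_choice[b bP] : forall i, exists b, cg_deg j.+2%:Z b /\ F i = b * u.
      by move=> i; have [b] := HF i; exists b.
    exists ((D1 *m \col_i b i) 0 0).
      have -> : j.+3%:Z = 1 + j.+2%:Z by lia.
      apply: (homogM (k3_deg1 k3)) => i i'; rewrite mxE; exact: proj1 (bP i).
    rewrite /= ldotE (@ffun_mul (\col_i b i)) ?mulmxA ?mulmx_const_mx // => i.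
    by rewrite mxE; exact: proj2 (bP i).
  have er2 : r2 = z1.
    apply: dim_eq_uniq dr2 _; apply: dim_eq_ext dz1 => F; split.
      case=> HF /= DF; have /functional_choice[b bP] : forall i, exists b, cg_deg j.+2%:Z b /\ F i = b * u.
        by move=> i; have [b] := HF i; exists b.
      have Fb : \col_i F i = (\col_i b i) *m const_mx u.
        by apply: ffun_mul => i; rewrite mxE; exact: proj2 (bP i).
      have Hb : homog_mx j.+2%:Z (\col_i b i) by move=> i i'; rewrite mxE; exact: proj1 (bP i).
      (* Subtracting [c] from the column of the [b i] makes it a cycle for [D1], and does not change
         F = b u because c u = 0. *)
      have [||c [Hc cu ec]] := ann j.+2 ((D1 *m \col_i b i) 0 0); first by lia.
        split; last by rewrite -mulmx_const_mx -mulmxA -Fb -ldotE.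
        have -> : j.+3%:Z = 1 + j.+2%:Z by lia.
        exact: homogM (k3_deg1 k3) Hb 0 0.
      have Hbc : homog_mx j.+2%:Z (\col_i b i - c) by apply: homog_mxB.
      have [|w Hw ew] := k3_col1 k3 Hbc.
        by apply/mx11_eq0; rewrite mulmxBr mxE [X in _ + X]mxE -ec subrr.
      exists [ffun i => w i 0 * u].
        move=> i; rewrite ffunE; by exists (w i 0) => //; apply: Hw.
      apply/ffunP=> l; rewrite mull_ffun_col (@ffun_mul w) => [|i]; last by rewrite ffunE.
      rewrite mulmxA -ew mulmx_const_mx !mxE mulrBl cu subr0.
      exact: proj2 (bP l).
    case=> G HG ->; have /functional_choice[b bP] : forall i, exists b, cg_deg j.+1%:Z b /\ G i = b * u.
      by move=> i; have [b] := HG i; exists b.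
    have Gb : \col_i G i = (\col_i b i) *m const_mx u.
      by apply: ffun_mul => i; rewrite mxE; exact: proj2 (bP i).
    have DG : \col_i mull_ffun D2 G i = D2 *m (\col_i b i) *m const_mx u.
      by apply/colP=> i; rewrite mxE mull_ffun_col Gb mulmxA.
    split; last by rewrite /= ldotE DG !mulmxA (k3_D12 k3) !mul0mx mxE.
    move=> i; exists ((D2 *m \col_i b i) i 0).
      have -> : j.+2%:Z = 1 + j.+1%:Z by lia.
      apply: (homogM (k3_deg2 k3)) => l l'; rewrite mxE; exact: proj1 (bP l).
    by have /colP/(_ i) := DG; rewrite mxE mulmx_const_mx.
  have ez2 : (d j).2 = z2.
    pose g (b : A) : {ffun 'I_3 -> A} := mull_ffun D3 [ffun=> b].
    have gL : linear g.
      move=> c y z; rewrite /g -linearP; congr mull_ffun.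
      by apply/ffunP=> i; rewrite !ffunE.
    pose gl : {linear A -> {ffun 'I_3 -> A}} := HB.pack g (GRing.isLinear.Build K _ _ _ g gL).
    have gE b i : gl b i = D3 i 0 * b by rewrite /= ffunE big_ord1 ffunE.
    apply: dim_eq_uniq (dim_eq_inj (g := gl) dMj _) _.
      move=> b /principal_deg Hb gb0.
      have : const_mx b = 0 :> 'M[A]_1.
        apply: (k3_col3 k3) (homog_scalar Hb) _; apply/colP=> i.
        by rewrite mulmx_const_mx -gE gb0 !mxE ffunE.
      by move/matrixP/(_ 0 0); rewrite !mxE.
    apply: dim_eq_ext dz2 => F; split; last first.
      case=> b [c Hc ->] ->; split.
        move=> i; rewrite gE; exists (D3 i 0 * c); last by rewrite mulrA.
        by rewrite -add1n PoszD; apply: cg_mul (k3_deg3 k3 i 0) Hc.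
      apply/mull_ffun_eq0.
      rewrite (_ : \col_i _ = D3 *m const_mx (c * u)) ?mulmxA ?(k3_D23 k3) ?mul0mx //.
      by apply/colP=> i; rewrite mxE gE mulmx_const_mx.
    case=> HF /mull_ffun_eq0 DF.
    have HF1 : homog_mx j.+2%:Z (\col_i F i).
      by move=> i i'; rewrite mxE; apply: principal_deg.
    have [w Hw ew] := k3_col2 k3 HF1 DF.
    have Fi i : F i = D3 i 0 * w 0 0.
      by have /colP/(_ i) := ew; rewrite !mxE big_ord1.
    exists (w 0 0); last by apply/ffunP=> i; rewrite gE.
    apply: soc => //.
    by move=> i; have [b _ eb] := HF i; exists b; rewrite -Fi.
  by move: e1 e2; rewrite er1 er2 -ez2; lia.
have [|[C HC]|[C HC]] := growth_dichotomy a2 _ rec (g := fun k => (d k).1).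
- by move=> k; case: (dP k).
- by left; exists C => k; apply: covered_leq (HC k) _; case: (dP k) => _ /dim_eq_covered.
- by right; exists C => k; apply: covered_leq (HC k) _; case: (dP k) => /dim_eq_covered.
Qed.

End PrincipalIdealDichotomy.

(** * Excluding columns of rank one in dimension three *)

Lemma cst_eq0 (K : fieldType) (A : cgAlg K) m n (c : 'M[K]_(m, n)) :
  cst A c = 0 -> c = 0.
Proof.
move/matrixP=> c0; apply/matrixP=> i j; have := c0 i j; rewrite !mxE /=.
by move/eqP; rewrite scaler_eq0 oner_eq0 orbF => /eqP.
Qed.

Lemma cst_op (K : fieldType) (A : cgAlg K) m n (c : 'M[K]_(m, n)) :
  cst (op A) c^T = (cst A c)^T :> 'M[op A]_(n, m).
Proof. by apply/matrixP=> i j; rewrite !mxE. Qed.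

(** With v = D1 t one gets v u = D1 D2 e = 0. If A u does not have linear growth, then lann(u) has,
    hence also A v inside it, then A v A, then v A. But v satisfies an identity of the same shape as
    u over the opposite algebra, where [principal_not_small] applies. *)
Lemma no_rank_one_column (K : fieldType) (A : cgAlg K) (a : nat -> nat)
    (D1 : 'M[A]_(1, 3)) (D2 : 'M[A]_3) (D3 : 'M[A]_(3, 1))
    (e t : 'cV[K]_3) (u : A) :
  (forall k : nat, dim_eq (@cg_deg K A k%:Z) (a k)) ->
  (forall k, 2 * a k = k.+1 * k.+2)%N ->
  noetherian A -> koszul3 D1 D2 D3 -> cg_deg 1 u ->
  D2 *m cst A e = cst A t *m const_mx u -> e != 0 -> t != 0 -> u != 0 -> False.
Proof.
move=> aP a2 [nl nr] k3 u1 D2e e0 t0 u0.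
have [small|small] := principal_dichotomy aP a2 k3 nl u1.
  exact: (principal_not_small aP a2 k3 D2e e0 nl small).
pose v := (D1 *m cst A t) 0 0.
have v1 : cg_deg 1 v by exact: (homogM (k3_deg1 k3) (homog_const _ _)).
have vu : v * u = 0.
  by rewrite -mulmx_const_mx -mulmxA -D2e mulmxA (k3_D12 k3) mul0mx mxE.
have v0 : v != 0.
  apply: contra t0 => /eqP/mx11_eq0 Dt; apply/eqP/(@cst_eq0 K A).
  have [w Hw ->] := k3_col1 k3 (homog_const _ _) Dt.
  by rewrite (homog_neg _ Hw) ?mulmx0.
have small_v : linear_growth (fun k z => exists2 b, cg_deg k%:Z b & z = b * v).
  case: small => C HC; exists (2 * C)%N => k.
  apply: (@covered_leq _ _ _ (C * k.+2)); first by nia.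
  apply: covered_sub (HC k.+1) => z [b Hb ->]; split; last by rewrite -mulrA vu mulr0.
  by rewrite -addn1 PoszD; apply: cg_mul.
have [||C HC] := two_sided_growth (W := eq v) nl _ small_v.
- by move=> w <-.
- by move=> k b w <- Hb; exists b.
(* Write u = t' D3 with a constant row t'. From v u = 0, the row v t' is a syzygy of D3, so v t' =
   e' D2 with e' constant: the identity D2 e = t u for [op A]. *)
have [w Hw uw] := k3_row0 k3 (homog_scalar u1) ltr01.
have [t' et'] := homog_deg0 Hw; rewrite {w Hw}et' in uw.
have Hr : homog_mx 1 ((const_mx v : 'M_1) *m cst A t').
  rewrite -[X in homog_mx X _]addr0.
  by apply: homogM; [exact: homog_scalar | exact: homog_const].
have [|w Hw ew] := k3_row1 k3 Hr.
  by rewrite -mulmxA -uw; apply/mx11_eq0; rewrite mulmx_const_mx mxE.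
have [e' ee'] := homog_deg0 Hw; rewrite {w Hw}ee' in ew.
have e'0 : e'^T != 0.
  rewrite trmx_eq0; apply: contraNneq u0 => e'0.
  have vt0 : t' = 0.
    apply/rowP=> j; rewrite mxE; have /matrixP/(_ 0 j) := ew.
    rewrite e'0 const_mx_mulmx map_mx0 mul0mx !mxE /= mulr_algr => /eqP.
    by rewrite scaler_eq0 (negPf v0) orbF => /eqP.
  have /matrixP/(_ 0 0) := uw; rewrite vt0 map_mx0.
  by rewrite mul0mx !mxE => ->.
apply: (principal_not_small (A := op A) (u := v) aP a2 (k3_op k3) (t := t'^T) _ e'0 nr).
  rewrite !cst_op mulmx_op -ew -mulmx_op; congr (_ *m _).
  by apply/matrixP=> i j; rewrite !mxE.
exists (2 * C)%N => k.
apply: (@covered_leq _ _ _ (C * k.+2)); first by nia.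
apply: (@covered_sub _ A _ _ _ _ (HC k.+1)) => z [b Hb ->]; split.
  by rewrite -add1n PoszD; apply: (cg_mul (c := A) v1 Hb).
by have := two_sided_gen (A := A) 1 b (erefl v); rewrite mul1r.
Qed.

(** * The (G1) condition *)

Lemma meval_homogZ (K : fieldType) n e (F : {mpoly K[n]}) (c : K) (v : 'I_n -> K) :
  F \is e.-homog -> F.@[fun i => c * v i] = c ^+ e * F.@[v].
Proof.
move=> /dhomogP He; rewrite !mevalE mulr_sumr big_seq [RHS]big_seq.
apply: eq_bigr => m mF; rewrite mulrCA; congr (_ * _).
have <- : mdeg m = e by exact: He.
rewrite mdegE -prodrXr -big_split; apply: eq_bigr => i _.
exact: exprMn.
Qed.

(** Since [f] is a function of vectors, compatibility with lines has to come from its local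
    formulas: the homogeneous [G] is nonzero at c p too, and the [F j] are all multiplied by c^e
    there. *)
Lemma proj_endo_scale (K : fieldType) n (E : 'rV[K]_n -> Prop) f (p : 'rV[K]_n) (c : K) :
  proj_endo E f -> c != 0 -> p != 0 -> E p -> E (c *: p) -> (f p == f (c *: p))%MS.
Proof.
move=> [_ fE] c0 p0 Ep Ecp.
have [e [e' [G [F [HG Gp HF fF]]]]] := fE p p0 Ep.
have ev (H : {mpoly K[n]}) d : H \is d.-homog -> H.@[(c *: p) 0] = c ^+ d * H.@[p 0].
  by move=> /(meval_homogZ c (p 0)) <-; apply: meval_eq => i; rewrite mxE.
have cp0 : c *: p != 0 by rewrite scaler_eq0 negb_or c0.
have Gcp : G.@[(c *: p) 0] != 0 by rewrite (ev G e') // mulf_neq0 // expf_neq0.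
have /eqmxP Fp := fF p p0 Ep Gp; have /eqmxP Fcp := fF _ cp0 Ecp Gcp.
have ce0 : c ^+ e != 0 by rewrite expf_neq0.
apply/eqmxP/(eqmx_trans (eqmx_sym Fp)); apply: eqmx_trans Fcp.
rewrite (_ : \row_j (F j).@[(c *: p) 0] = c ^+ e *: \row_j (F j).@[p 0]).
  exact/eqmx_sym/eqmx_scale.
by apply/rowP=> j; rewrite !mxE (ev (F j) e).
Qed.

Lemma eqmx_rV_scale (K : fieldType) n (p q : 'rV[K]_n) :
  p != 0 -> (p == q)%MS -> exists2 c, c != 0 & q = c *: p.
Proof.
move=> p0 /andP[/sub_rVP[d ed] /sub_rVP[c ec]]; exists c => //.
by apply: contraNneq p0 => c0; rewrite ed ec c0 scale0r scaler0.
Qed.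

(** The consequence of (G1) used for ranks: on lines, [Z] is the graph of a bijection of a set of
    points onto itself. This form is symmetric, so it passes to the opposite algebra. *)
Record unique_partners (K : fieldType) n (Z : 'rV[K]_n -> 'rV[K]_n -> Prop) : Prop := {
  up_right : forall p q q', p != 0 -> q != 0 -> q' != 0 -> Z p q -> Z p q' -> (q' <= q)%MS;
  up_left : forall p p' q, p != 0 -> p' != 0 -> q != 0 -> Z p q -> Z p' q -> (p' <= p)%MS;
  up_ex : forall p, p != 0 ->
    (exists2 q, q != 0 & Z p q) <-> (exists2 q, q != 0 & Z q p)
}.

Lemma unique_partnersC (K : fieldType) n (Z : 'rV[K]_n -> 'rV[K]_n -> Prop) :
  unique_partners Z -> unique_partners (fun p q => Z q p).
Proof.
case=> R L X; split; first by move=> p q q' *; apply: (L q q' p).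
  by move=> p q q' *; apply: (R q' p q).
by move=> p p0; rewrite (X p p0).
Qed.

Lemma G1_unique_partners (K : fieldType) (A : cgAlg K) n (x : 'I_n -> A) :
  G1 x -> unique_partners (zero_locus x).
Proof.
move=> [E [f [_ [[fE fP] [f' [f'E f'P] ff']] ZE]]].
have Zscale p q c : zero_locus x p q -> zero_locus x (c *: p) q.
  move=> Z g /Z Zg; rewrite -[RHS](mulr0 c) -[in RHS]Zg mulr_sumr.
  apply: eq_bigr => i _; rewrite mulr_sumr; apply: eq_bigr => j _.
  by rewrite mxE; ring.
have Zf p : p != 0 -> E p -> zero_locus x p (f p).
  by move=> p0 Ep; apply/ZE; rewrite ?submx_refl //; case: (fE p p0 Ep).
(* [q] is a multiple of [f p], and the zero locus is stable under scaling; so [q] has the partner f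
   (f p), which puts the vector [q] itself in [E]. *)
have Zright p q : p != 0 -> q != 0 -> zero_locus x p q -> E q.
  move=> p0 q0 /(ZE p q p0 q0)[Ep qf].
  have [fp0 Efp] := fE p p0 Ep.
  have [c c0 eq] : exists2 c, c != 0 & q = c *: f p.
    by apply: eqmx_rV_scale fp0 _; rewrite andbC.
  have [ffp0 _] := fE _ fp0 Efp.
  by have /(ZE q _ q0 ffp0)[] : zero_locus x q (f (f p)) by rewrite eq; apply/Zscale/Zf.
split.
- move=> p q q' p0 q0 q'0 /(ZE _ _ p0 q0)[_ /andP[_ qf]] /(ZE _ _ p0 q'0)[_ /andP[q'f _]].
  exact: submx_trans q'f qf.
- move=> p p' q p0 p'0 q0 Zp Zp'.
  have [Ep qf] := proj1 (ZE _ _ p0 q0) Zp; have [Ep' qf'] := proj1 (ZE _ _ p'0 q0) Zp'.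
  have [fp0 Efp] := fE p p0 Ep; have [fp'0 Efp'] := fE p' p'0 Ep'.
  have [c c0 ec] : exists2 c, c != 0 & f p' = c *: f p.
    apply: eqmx_rV_scale fp0 _; case/andP: qf => h1 h2; case/andP: qf' => h3 h4.
    by rewrite (submx_trans h2 h3) (submx_trans h4 h1).
  have /andP[_ h] : (f' (f p) == f' (f p'))%MS.
    by rewrite ec; apply: (proj_endo_scale (E := E)) => //; rewrite -ec.
  have [/andP[h1 _] _] := ff' p p0 Ep; have [/andP[_ h2] _] := ff' p' p'0 Ep'.
  exact: submx_trans h2 (submx_trans h h1).
move=> p p0; split=> [[q q0 /(ZE _ _ p0 q0)[Ep _]]|[q q0 Zq]].
  have [f'p0 Ef'p] := f'E p p0 Ep; exists (f' p) => //.
  by apply/ZE => //; split=> //; have [_] := ff' p p0 Ep; rewrite andbC.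
by exists (f p); [case: (fE p p0 (Zright _ _ q0 p0 Zq)) | apply/Zf/(Zright _ _ q0 p0)].
Qed.

(** * Matrices of linear forms at a point *)

Section LinearForms.
Variables (K : fieldType) (A : cgAlg K) (n : nat) (x : 'I_n -> A).
Hypothesis x_basis : is_basis (@cg_deg K A 1) x.

Lemma lin_form_eq0 (c : 'I_n -> K) : \sum_k c k *: x k = 0 -> forall k, c k = 0.
Proof.
move=> c0 k; have [_ /(_ 0)[|d [_ ud]]] := x_basis; first exact: homog0 (cg_grading A) _.
have : \row_k c k = 0.
  transitivity d; last by apply: ud; rewrite big1 // => j _; rewrite mxE scale0r.
  symmetry; apply: ud; rewrite -[LHS]c0.
  by apply: eq_bigr => j _; rewrite mxE.
by move/rowP/(_ k); rewrite !mxE.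
Qed.

Lemma lmx_alg_inj a b (D D' : lin_mx K n a b) : lmx_alg x D = lmx_alg x D' -> D =1 D'.
Proof.
move=> /matrixP DD' k; apply/matrixP=> i j; apply/eqP; rewrite -subr_eq0; apply/eqP.
apply: (@lin_form_eq0 (fun k => D k i j - D' k i j)).
have := DD' i j; rewrite !mxE => /eqP; rewrite -subr_eq0 -sumrB => /eqP e0; rewrite -[RHS]e0.
by apply: eq_bigr => l _; rewrite scalerBl.
Qed.

Lemma cst_lmx a b c (M : 'M[K]_(a, b)) (D : lin_mx K n b c) :
  cst A M *m lmx_alg x D = lmx_alg x (fun k => M *m D k).
Proof.
apply/matrixP=> i j; rewrite !mxE.
under [RHS]eq_bigr do rewrite mxE scaler_suml.
rewrite exchange_big; apply: eq_bigr => l _; rewrite !mxE /= mulr_algl scaler_sumr.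
by apply: eq_bigr => k _; rewrite scalerA.
Qed.

Lemma lmx_cst a b c (M : 'M[K]_(b, c)) (D : lin_mx K n a b) :
  lmx_alg x D *m cst A M = lmx_alg x (fun k => D k *m M).
Proof.
apply/matrixP=> i j; rewrite !mxE.
under [RHS]eq_bigr do rewrite mxE scaler_suml.
rewrite exchange_big; apply: eq_bigr => l _; rewrite !mxE /= mulr_algr scaler_sumr.
by apply: eq_bigr => k _; rewrite scalerA mulrC.
Qed.

Definition coef_mx m (D : lin_mx K n m 1) : 'M[K]_(m, n) := \matrix_(i, k) D k i 0.

Lemma lmx_at_coef m (D : lin_mx K n m 1) p : lmx_at D p = coef_mx D *m p^T.
Proof.
apply/colP=> i; rewrite /lmx_at summxE mxE; apply: eq_bigr => k _.
by rewrite !mxE mulrC.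
Qed.

Lemma lmx_alg_coef m (D : lin_mx K n m 1) : lmx_alg x D = cst A (coef_mx D) *m \col_k x k.
Proof.
by apply/colP=> i; rewrite !mxE; apply: eq_bigr => k _; rewrite !mxE /= mulr_algl.
Qed.

Lemma lmx_at_tr a b (D : lin_mx K n a b) p : lmx_at (fun k => (D k)^T) p = (lmx_at D p)^T.
Proof. by rewrite /lmx_at linear_sum; apply: eq_bigr => k _; rewrite linearZ. Qed.

Lemma lmx_alg_op a b (D : lin_mx K n a b) :
  lmx_alg (x : 'I_n -> op A) (fun k => (D k)^T) = (lmx_alg x D)^T :> 'M[op A]_(b, a).
Proof. by apply/matrixP=> i j; rewrite !mxE; apply: eq_bigr => k _; rewrite mxE. Qed.

(** The entries of the column span A_1: [N] expresses the x_k through them. *)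
Definition spans_forms m (D : lin_mx K n m 1) : Prop :=
  exists N : 'M[K]_(n, m), N *m coef_mx D = 1%:M.

Lemma spans_formsP m (D : lin_mx K n m 1) :
  (forall k, exists c : 'rV[K]_m, const_mx (x k) = cst A c *m lmx_alg x D) -> spans_forms D.
Proof.
case/functional_choice => N NP; exists (\matrix_k N k).
apply/row_matrixP=> k; rewrite row_mul rowK.
apply/rowP=> l; have := NP k; rewrite cst_lmx.
have -> : const_mx (x k) = lmx_alg x (fun l => const_mx (k == l)%:R : 'M_1).
  apply/matrixP=> i j; rewrite !mxE (bigD1 k) //= mxE eqxx scale1r big1 ?addr0 //.
  by move=> l' l'k; rewrite mxE eq_sym (negPf l'k) scale0r.
move/lmx_alg_inj/(_ l)/matrixP/(_ 0 0); rewrite !mxE => ->.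
by apply: eq_bigr => i _; rewrite mxE.
Qed.

Lemma spans_forms_at_neq0 m (D : lin_mx K n m 1) p :
  spans_forms D -> p != 0 -> lmx_at D p != 0.
Proof.
case=> N ND; apply: contraNneq; rewrite lmx_at_coef => Dp.
by rewrite -[p]trmxK -[p^T]mul1mx -ND -mulmxA Dp mulmx0 trmx0.
Qed.

End LinearForms.

(* Here lmx_alg x D *m lmx_alg x D0 = 0 lists the quadratic relations, so the  *)
(* points of the zero locus over p are the kernel of D at p.                   *)
Section RelationKernel.
Variables (K : fieldType) (A : cgAlg K) (n : nat) (x : 'I_n -> A).
Hypothesis x_basis : is_basis (@cg_deg K A 1) x.
Variables (m : nat) (D0 : lin_mx K n n 1) (D : lin_mx K n m n).
Hypothesis D0_span : spans_forms D0.
Hypothesis DD0 : lmx_alg x D *m lmx_alg x D0 = 0.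
Hypothesis D_exact : forall w : 'rV[A]_n, homog_mx 1 w -> w *m lmx_alg x D0 = 0 ->
  exists2 b, homog_mx 0 b & w = b *m lmx_alg x D.

Let x1 k : cg_deg 1 (x k). Proof. by case: x_basis. Qed.

Lemma relationE (g : 'M[K]_n) :
  relation x g <-> (\row_i x i) *m cst A g *m \col_j x j = 0.
Proof.
suff -> : (\row_i x i) *m cst A g *m \col_j x j = const_mx (\sum_i \sum_j g i j *: (x i * x j)).
  split=> [->|/matrixP/(_ 0 0)]; last by rewrite !mxE.
  by apply/matrixP=> i j; rewrite !mxE.
apply/matrixP=> i j; rewrite !mxE exchange_big; apply: eq_bigr => l _.
rewrite !mxE mulr_suml; apply: eq_bigr => k _.
by rewrite !mxE /= mulr_algr scalerAl.
Qed.

(** Each entry of the product of [D] and [D0] is a relation. Conversely, a relation g equals w D0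
    with w = x (g N); then w is killed by D0, hence is a constant combination of the rows of [D]. *)
Lemma zero_locusE p q : zero_locus x p q <-> lmx_at D p *m lmx_at D0 q = 0.
Proof.
have [N ND] := D0_span; have DN := mulmx1C ND.
have form_eval (g : 'M[K]_n) : \sum_i \sum_j g i j * p 0 i * q 0 j = (p *m g *m q^T) 0 0.
  rewrite mxE exchange_big; apply: eq_bigr => j _; rewrite !mxE mulr_suml.
  by apply: eq_bigr => i _; rewrite [g i j * _]mulrC.
split=> [Z|Dpq g /relationE Rg].
  apply/colP=> r; rewrite [RHS]mxE.
  pose g := (\matrix_i row r (D i)) *m coef_mx D0.
  have pg : p *m g = row r (lmx_at D p) *m coef_mx D0.
    rewrite /g mulmxA; congr (_ *m _); apply/rowP=> l.
    by rewrite !mxE /lmx_at summxE; apply: eq_bigr => k _; rewrite !mxE.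
  transitivity ((p *m g *m q^T) 0 0); first by rewrite pg -mulmxA -lmx_at_coef -row_mul [RHS]mxE.
  rewrite -form_eval; apply: Z; apply/relationE; rewrite map_mxM -!mulmxA -lmx_alg_coef.
  have -> : (\row_i x i) *m (cst A (\matrix_i row r (D i)) *m lmx_alg x D0)
      = row r (lmx_alg x D *m lmx_alg x D0); last by rewrite DD0 row0.
  rewrite mulmxA row_mul; congr (_ *m _); apply/rowP=> l; rewrite !mxE.
  by apply: eq_bigr => k _; rewrite !mxE /= mulr_algr.
pose w := (\row_i x i) *m cst A (g *m N).
have [||b Hb ew] := D_exact (w := w).
- move=> i j; rewrite /w mxE; apply: (homog_sum (cg_grading A)) => k _.
  by rewrite !mxE /= mulr_algr; apply: degZ.
- by rewrite /w lmx_alg_coef mulmxA -[_ *m cst A _ *m cst A _]mulmxA -map_mxM -[g *m N *m _]mulmxA ND mulmx1.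
have [c ec] := homog_deg0 Hb.
have gN k : row k (g *m N) = c *m D k.
  have e1 : w = lmx_alg x (fun k => row k (g *m N)).
    apply/rowP=> j; rewrite [LHS]mxE mxE; apply: eq_bigr => l _.
    by rewrite !mxE /= mulr_algr.
  by move: ew; rewrite e1 ec cst_lmx => /(lmx_alg_inj x_basis)/(_ k).
have pgN : p *m (g *m N) = c *m lmx_at D p.
  rewrite mulmx_sum_row /lmx_at mulmx_sumr; apply: eq_bigr => k _.
  by rewrite gN scalemxAr.
have e : p *m g *m q^T = p *m (g *m N) *m (coef_mx D0 *m q^T).
  by rewrite -[g in LHS]mulmx1 -ND !mulmxA.
by rewrite form_eval e -lmx_at_coef pgN -mulmxA Dpq mulmx0 mxE.
Qed.

Lemma kernel_lift p (y : 'cV[K]_n) : lmx_at D p *m y = 0 -> y != 0 ->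
  exists q, [/\ q != 0, lmx_at D0 q = y & zero_locus x p q].
Proof.
have [N ND] := D0_span; have DN := mulmx1C ND.
move=> Dy y0; exists (N *m y)^T.
have e : lmx_at D0 (N *m y)^T = y by rewrite lmx_at_coef trmxK mulmxA DN mul1mx.
split=> //; last by apply/zero_locusE; rewrite e.
by apply: contraNneq y0 => q0; rewrite -e q0 lmx_at_coef trmx0 mulmx0.
Qed.

Lemma kernel_neq0 p : (exists2 q, q != 0 & zero_locus x p q) <->
  (\rank (lmx_at D p) < n)%N.
Proof.
split=> [[q q0 /zero_locusE Dq]|rk].
  rewrite ltn_neqAle rank_leq_col andbT; apply: contraNneq (spans_forms_at_neq0 D0_span q0) => rk.
  have : row_free (lmx_at D p)^T by rewrite /row_free mxrank_tr rk.
  move=> fr; apply/eqP/trmx_inj/(row_free_inj fr).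
  by rewrite trmx0 mul0mx -trmx_mul Dq trmx0.
have : kermx (lmx_at D p)^T != 0.
  by rewrite kermx_eq0 /row_free mxrank_tr neq_ltn rk.
case/rowV0Pn => v /sub_kermxP vD v0.
have [||q [q0 _ Z]] := @kernel_lift p v^T; last by exists q.
  by rewrite -[RHS]trmx0 -vD trmx_mul trmxK.
by rewrite trmx_eq0.
Qed.

(** [D0] carries the partners of [p] onto the nonzero vectors in the kernel of [D] at [p], so their
    uniqueness makes this kernel a line. *)
Lemma rank_unique_partner p : unique_partners (zero_locus x) -> p != 0 ->
  (\rank (lmx_at D p) < n)%N -> (\rank (lmx_at D p)).+1 = n.
Proof.
move=> up p0 rk; have [q q0 Zq] := proj2 (kernel_neq0 p) rk.
have [N ND] := D0_span; have DN := mulmx1C ND.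
have frN : row_free (coef_mx D0)^T.
  by apply/row_freeP; exists N^T; rewrite -trmx_mul ND trmx1.
have : (kermx (lmx_at D p)^T <= q *m (coef_mx D0)^T)%MS.
  apply/rV_subP => v /sub_kermxP vD.
  have [->|v0] := eqVneq v 0; first exact: sub0mx.
  have [||q' [q'0 e Z]] := @kernel_lift p v^T.
  - by rewrite -[RHS]trmx0 -vD trmx_mul trmxK.
  - by rewrite trmx_eq0.
  rewrite -[v]trmxK -e lmx_at_coef trmx_mul trmxK submxMr //.
  exact: (up_right up p0 q0 q'0 Zq Z).
move/mxrankS; rewrite mxrank_ker mxrank_tr => h.
have := leq_trans h (rank_leq_row _); lia.
Qed.

End RelationKernel.

(** * Ranks at the points *)

Lemma rank_le1 (K : fieldType) m n (M : 'M[K]_(m, n)) :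
  (\rank M <= 1)%N -> exists (t : 'cV[K]_m) (w : 'rV[K]_n), M = t *m w.
Proof.
case: (posnP (\rank M)) => [/eqP|r0 r1].
  by rewrite mxrank_eq0 => /eqP->; exists 0, 0; rewrite mulmx0.
have := mulmx_base M; move: (col_base M) (row_base M).
by have -> : \rank M = 1%N by [lia]; move=> t w <-; exists t, w.
Qed.

Section PointRanks.
Variables (K : fieldType) (A : cgAlg K) (n : nat) (x : 'I_n -> A).
Hypothesis x_basis : is_basis (@cg_deg K A 1) x.

Let x1 k : cg_deg 1 (x k). Proof. by case: x_basis. Qed.

Lemma lmx_alg_eq0 a b (D : lin_mx K n a b) : lmx_alg x D = 0 -> forall k, D k = 0.
Proof.
move=> D0; apply: (lmx_alg_inj x_basis (D' := fun=> 0)); rewrite D0.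
by apply/matrixP=> i j; rewrite !mxE big1 // => k _; rewrite ?mxE scale0r.
Qed.

Lemma rank_point_col m m' (D : lin_mx K n m m') p : m' = 1%N ->
  (forall k, exists c : 'rV[K]_m, const_mx (x k) = cst A c *m lmx_alg x D :> 'M_(1, m')) ->
  p != 0 -> \rank (lmx_at D p) = 1%N.
Proof.
move=> e; subst m' => span p0.
have := spans_forms_at_neq0 (spans_formsP x_basis span) p0.
by rewrite -mxrank_tr rank_rV trmx_eq0 => ->.
Qed.

Lemma partner_rank m m0 m1 (D0 : lin_mx K n m1 m0) (D : lin_mx K n m m1) :
  m0 = 1%N -> m1 = n ->
  (forall k, exists c : 'rV[K]_m1, const_mx (x k) = cst A c *m lmx_alg x D0 :> 'M_(1, m0)) ->
  lmx_alg x D *m lmx_alg x D0 = 0 ->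
  (forall w : 'rV[A]_m1, homog_mx 1 w -> w *m lmx_alg x D0 = 0 ->
    exists2 b, homog_mx 0 b & w = b *m lmx_alg x D) ->
  unique_partners (zero_locus x) -> forall p, p != 0 ->
  ((exists2 q, q != 0 & zero_locus x p q) <-> (\rank (lmx_at D p) < n)%N) /\
  ((\rank (lmx_at D p) < n)%N -> (\rank (lmx_at D p)).+1 = n).
Proof.
move=> e0 e1; subst m0 m1 => /(spans_formsP x_basis) span DD0 ex up p p0; split.
  exact: (kernel_neq0 x_basis span DD0 ex).
exact: (rank_unique_partner x_basis span DD0 ex up).
Qed.

(** Let D2, D3 be the matrices of [H1], [H0]. For a constant column c, rewriting D2 c through the
    entries of D3 gives the row Phi c = D1 (Gam c N) with (Phi c) D3 = D1 D2 c = 0. Hence Phi c = b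
    D2 with b constant, and Phi is injective because cycles of degree 0 vanish. Put q = H0(p), so N
    q is p transposed. If H1(p) c = 0, then b D2 q = (Phi c) q = D1 H1(p) c = 0. A rank at most 1 at
    p provides two independent such b, so Gam q has rank 1, that is D2 q = t u, contrary to
    [no_rank_one_column]. *)
Lemma koszul3_rank (a : nat -> nat) m0 m1 m2 m3
    (D1 : 'M[A]_(m0, m1)) (H1 : lin_mx K n m1 m2) (H0 : lin_mx K n m2 m3) p :
  m0 = 1%N -> m1 = 3%N -> m2 = 3%N -> m3 = 1%N ->
  (forall k : nat, dim_eq (@cg_deg K A k%:Z) (a k)) ->
  (forall k, 2 * a k = k.+1 * k.+2)%N -> noetherian A ->
  koszul3 D1 (lmx_alg x H1) (lmx_alg x H0) -> p != 0 ->
  (1 < \rank (lmx_at H1 p))%N.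
Proof.
move=> e0 e1 e2 e3; subst m0 m1 m2 m3 => aP a2 noeth k3 p0.
rewrite ltnNge; apply/negP => rk.
have H0_span : spans_forms H0.
  apply: (spans_formsP x_basis) => k.
  have [w Hw ->] := k3_row0 k3 (homog_scalar (x1 k)) ltr01.
  by have [c ->] := homog_deg0 Hw; exists c.
have q0 := spans_forms_at_neq0 H0_span p0.
have [N NH] := H0_span.
set q := lmx_at H0 p in q0.
have Nq : N *m q = p^T by rewrite /q lmx_at_coef mulmxA NH mul1mx.
pose Gam (c : 'cV[K]_3) := coef_mx (fun k => H1 k *m c).
have GamE c : lmx_alg x H1 *m cst A c = cst A (Gam c) *m \col_k x k.
  by rewrite lmx_cst lmx_alg_coef.
have GamN c : Gam c *m N *m coef_mx H0 = Gam c by rewrite -mulmxA NH mulmx1.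
pose Phi c := D1 *m cst A (Gam c *m N).
have ex c : exists b : 'rV[K]_3, Phi c = cst A b *m lmx_alg x H1.
  have [||w Hw ew] := k3_row1 k3 (k := 1) (r := Phi c).
  - exact: (homogM (k3_deg1 k3) (homog_const _ _)).
  - rewrite /Phi lmx_alg_coef -mulmxA [cst A (Gam c *m N) *m _]mulmxA -map_mxM GamN -GamE.
    by rewrite mulmxA (k3_D12 k3) mul0mx.
  by have [b eb] := homog_deg0 Hw; exists b; rewrite -eb.
have Phi_eq0 c : Phi c = 0 -> c = 0.
  move=> P0; have : Gam c *m N = 0.
    apply/trmx_inj/row_matrixP=> j; rewrite trmx0 row0 -tr_col; apply/trmx_inj; rewrite trmxK trmx0.
    apply: (@cst_eq0 K A).
    have [|w Hw ->] := k3_col1 k3 (homog_const A (col j (Gam c *m N))).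
      by rewrite map_col colE mulmxA -/(Phi c) P0 mul0mx.
    by rewrite (homog_neg _ Hw) ?mulmx0.
  move=> GN0; have := GamE c; rewrite -GamN GN0 mul0mx.
  rewrite map_mx0 mul0mx => Hc; apply: (@cst_eq0 K A).
  have [w Hw ->] := k3_col2 k3 (homog_const A c) Hc.
  by rewrite (homog_neg _ Hw) ?mulmx0.
pose G j := \sum_k N k j *: H1 k.
pose phi j (c : 'cV[K]_3) := \sum_i (G j *m c) i 0 *: D1 0 i.
have phi_lin j : linear (phi j).
  move=> b u v; rewrite /phi scaler_sumr -big_split; apply: eq_bigr => i _.
  by rewrite mulmxDr -scalemxAr !mxE scalerDl scalerA.
have PhiE c j : Phi c 0 j = phi j c.
  rewrite /Phi mxE; apply: eq_bigr => i _; rewrite [cst A _ _ _]mxE /= mulr_algr.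
  congr (_ *: _); rewrite mulmx_suml summxE mxE; apply: eq_bigr => k _.
  by rewrite /Gam -scalemxAl !mxE mulrC.
pose C := row_base (kermx (lmx_at H1 p)^T).
have CH i : lmx_at H1 p *m (row i C)^T = 0.
  have : (row i C <= kermx (lmx_at H1 p)^T)%MS.
    by apply: submx_trans (row_sub i C) _; rewrite eq_row_base.
  by move/sub_kermxP => CM; rewrite -[RHS]trmx0 -CM trmx_mul trmxK.
have [b bP] := functional_choice _ (fun i => ex (row i C)^T).
pose B := \matrix_i b i.
have frB : row_free B.
  rewrite -kermx_eq0; apply/eqP/row_matrixP=> i; rewrite row0.
  set z := row i _.
  have zB : z *m B = 0 by rewrite /z -row_mul mulmx_ker row0.
  suff zC : z *m C = 0 by apply: (row_free_inj (row_base_free _) _); rewrite zC mul0mx.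
  apply/trmx_inj; rewrite trmx0; apply: Phi_eq0; apply/rowP=> j; rewrite PhiE [RHS]mxE.
  pose pl : {linear 'cV[K]_3 -> A} :=
    HB.pack (phi j) (GRing.isLinear.Build K _ _ _ (phi j) (phi_lin j)).
  rewrite -[phi j]/(pl : _ -> _) mulmx_sum_row linear_sum linear_sum /=.
  transitivity ((cst A (z *m B) *m lmx_alg x H1) 0 j); last first.
    by rewrite zB map_mx0 mul0mx mxE.
  rewrite map_mxM -mulmxA mxE; apply: eq_bigr => l _.
  rewrite linearZ -[phi j]/(pl : _ -> _) linearZ /= -PhiE bP.
  rewrite [X in _ = X * _]mxE /= mulr_algl; congr (_ *: _); rewrite [LHS]mxE [RHS]mxE.
  by apply: eq_bigr => k _; rewrite [in RHS]mxE mxE [B _ _]mxE.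
have BG : B *m Gam q = 0.
  apply/row_matrixP=> i; rewrite row_mul rowK row0.
  have : lmx_alg x (fun k => b i *m (H1 k *m q)) = 0.
    rewrite -cst_lmx -lmx_cst mulmxA -bP /Phi -mulmxA -map_mxM -mulmxA Nq.
    have -> : Gam (row i C)^T *m p^T = 0.
      rewrite -lmx_at_coef; rewrite -[RHS](CH i) /lmx_at mulmx_suml.
      by apply: eq_bigr => k _; rewrite scalemxAl.
    by rewrite map_mx0 mulmx0.
  move/lmx_alg_eq0 => bH; apply/rowP=> k.
  transitivity ((b i *m (H1 k *m q)) 0 0); last by rewrite bH !mxE.
  by rewrite [LHS]mxE [RHS]mxE; apply: eq_bigr => j _; rewrite [Gam q _ _]mxE.
have rG : (\rank (Gam q) <= 1)%N.
  have := mulmx0_rank_max BG; rewrite (eqP frB) mxrank_ker mxrank_tr; lia.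
have [t [w Gtw]] := rank_le1 rG.
have Gq0 : Gam q != 0.
  apply: contra_neq q0 => Gq; apply: Phi_eq0.
  by rewrite /Phi Gq mul0mx map_mx0 mulmx0.
pose u := \sum_k w 0 k *: x k.
apply: (no_rank_one_column (u := u) aP a2 noeth k3 _ _ q0).
- by apply: (homog_sum (cg_grading A)) => k _; apply: degZ.
- rewrite GamE Gtw map_mxM -mulmxA; congr (_ *m _); apply/matrixP=> i j; rewrite !mxE.
  by apply: eq_bigr => k _; rewrite !mxE /= mulr_algl ord1.
- by apply: contraNneq Gq0 => t0; rewrite Gtw t0 mul0mx.
apply: contraNneq Gq0 => /(lin_form_eq0 x_basis) w0.
rewrite Gtw [w](_ : _ = 0) ?mulmx0 //; apply/rowP=> k.
by rewrite w0 mxE.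
Qed.

End PointRanks.

(** * Quantum polynomial algebras *)

Lemma hilbert_qpoly_deg1 (K : fieldType) (A : cgAlg K) n N (x : 'I_n -> A) :
  is_basis (@cg_deg K A 1) x -> hilbert_qpoly A N -> n = N.
Proof.
move=> xb [a [aP aH]].
have a1 : dim_eq (@cg_deg K A 1) (a 1%N).
  by have [b Hb] := aP 1%N; apply: dim_eq_basis Hb; apply: deg_subspace.
rewrite (dim_eq_uniq (dim_eq_basis (deg_subspace A 1) xb) a1).
have := aH 0%N; have := aH 1%N.
rewrite !big_ord_recl !big_ord0 /= !coef_1subX_exp bin0 bin1 /bump /=.
rewrite !expr0 !expr1 !mul1r !addr0 !subn0 subnn => + a0.
rewrite a0; lia.
Qed.

Lemma hilbert_qpoly3 (a : nat -> nat) :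
  (forall k : nat, \sum_(j < k.+1) ((1 - 'X) ^+ 3 : {poly int})`_j * (a (k - j)%N)%:Z
     = (k == 0%N)%:Z) ->
  (forall k, 2 * a k = k.+1 * k.+2)%N.
Proof.
move=> aH.
have coefE j : ((1 - 'X) ^+ 3 : {poly int})`_j = (-1) ^+ j * ('C(3, j))%:Z.
  exact: coef_1subX_exp.
have a0 : a 0%N = 1%N.
  by have := aH 0%N; rewrite big_ord1 coefE expr0 bin0 !mul1r subnn => -[].
have a1 : a 1%N = 3%N.
  have := aH 1%N; rewrite !big_ord_recl big_ord0 /= !coefE /bump /= expr0 expr1 bin0 bin1.
  by rewrite !subn0 subnn a0; lia.
have a2 : a 2%N = 6%N.
  have := aH 2%N; rewrite !big_ord_recl big_ord0 /= !coefE /bump /= bin0 bin1.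
  by rewrite !addn0 !addn1 !subn0 (_ : 2 - 1 = 1)%N // subnn a0 a1 (_ : 'C(3, 2) = 3%N) //; lia.
have rec k : (a k.+3 + 3 * a k.+1 = 3 * a k.+2 + a k)%N.
  have := aH k.+3; rewrite 4!big_ord_recl big1 => [|i _]; last first.
    by rewrite coefE bin_small ?mulr0 ?mul0r.
  rewrite /= !coefE /bump /= !addn0 !addn1 bin0 bin1 binn (_ : 'C(3, 2) = 3%N) //.
  have [-> [-> ->]] : (k.+3 - 1 = k.+2 /\ k.+3 - 2 = k.+1 /\ k.+3 - 3 = k)%N by lia.
  by rewrite subn0 !exprS expr0; lia.
move=> k; suff [] : (2 * a k = k.+1 * k.+2 /\ 2 * a k.+1 = k.+2 * k.+3 /\
  2 * a k.+2 = k.+3 * k.+4)%N by [].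
elim: k => [|k [IH0 [IH1 IH2]]]; first by rewrite a0 a1 a2.
by do 2!split=> //; have := rec k; lia.
Qed.

Lemma zero_locus_op (K : fieldType) (A : cgAlg K) n (x : 'I_n -> A) p q :
  zero_locus (A := op A) x p q <-> zero_locus x q p.
Proof.
have rel_op (B : cgAlg K) (y : 'I_n -> B) g : relation (A := op B) y g <-> relation y g^T.
  have E : \sum_i \sum_j g i j *: ((y i : op B) * (y j : op B))
      = \sum_i \sum_j g^T i j *: (y i * y j) :> B.
    rewrite [RHS]exchange_big; apply: eq_bigr => i _; apply: eq_bigr => j _.
    by rewrite mxE.
  by split=> H; [exact: etrans (esym E) H | exact: etrans E H].
have swap (g : 'M[K]_n) (u v : 'rV[K]_n) :
    \sum_i \sum_j g^T i j * u 0 i * v 0 j = \sum_i \sum_j g i j * v 0 i * u 0 j.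
  rewrite exchange_big; apply: eq_bigr => j _; apply: eq_bigr => i _.
  by rewrite mxE; ring.
split=> Z g Rg; rewrite -swap; apply: Z; last exact/rel_op.
by apply/rel_op; rewrite trmxK.
Qed.

Lemma unique_partners_op (K : fieldType) (A : cgAlg K) n (x : 'I_n -> A) :
  unique_partners (zero_locus x) -> unique_partners (zero_locus (A := op A) x).
Proof.
move=> /unique_partnersC [R L X]; split.
- by move=> p q q' p0 q0 q'0 /zero_locus_op Z /zero_locus_op; apply: R Z.
- by move=> p p' q p0 p'0 q0 /zero_locus_op Z /zero_locus_op; apply: L Z.
move=> p p0; split=> -[q q0 /zero_locus_op Z].
  have [|q' q'0 Z'] := proj1 (X p p0); first by exists q.
  by exists q' => //; apply/zero_locus_op.
have [|q' q'0 Z'] := proj2 (X p p0); first by exists q.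
by exists q' => //; apply/zero_locus_op.
Qed.

Lemma mx_no_rows (R : nmodType) m n (M : 'M[R]_(m, n)) : m = 0%N -> M = 0.
Proof. by move=> m0; subst m; exact: flatmx0. Qed.

(** * Ranks of the differentials of a left linear resolution at a point *)

Section LeftPointExact.
Variables (K : fieldType) (A : cgAlg K) (n N : nat) (x : 'I_n -> A).
Hypothesis x_basis : is_basis (@cg_deg K A 1) x.
Hypothesis noeth : noetherian A.
Hypothesis gor : gorenstein A N.
Hypothesis hilb : hilbert_qpoly A N.
Variables (s : nat -> nat) (h : forall i, lin_mx K n (s i.+1) (s i)).
Hypothesis hP : left_linear_resolution x h.

Let x1 k : cg_deg 1 (x k). Proof. by case: x_basis. Qed.
Let sE : forall j, s j = 'C(N, j). Proof. exact (lres_rank x1 hP hilb). Qed.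
Let nN : n = N. Proof. exact: hilbert_qpoly_deg1 x_basis hilb. Qed.

Lemma lres_span0 k : exists c : 'rV[K]_(s 1),
  const_mx (x k) = cst A c *m lmx_alg x (h 0) :> 'M_(1, s 0).
Proof.
have [||w Hw ->] := lres_aug_homog x1 hP (k := 1) (v := const_mx (x k)).
- by move=> i j; rewrite mxE.
- exact: ltr01.
by have [c ->] := homog_deg0 Hw; exists c.
Qed.

(** In position [N] every column is a cocycle, since the next free module is zero. This one has
    degree 1, whereas the only cohomology there has degree 0, so it is a coboundary. *)
Lemma lres_span_last k i : i.+1 = N -> exists c : 'cV[K]_(s i),
  const_mx (x k) = lmx_alg x (h i) *m cst A c :> 'M_(s i.+1, 1).
Proof.
move=> iN; have [|||w Hw ->] := gorenstein_exactS x1 hP (k := 1) (w := const_mx (x k)) gor (i := i).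
- by rewrite orbT.
- by move=> j l; rewrite mxE.
- by apply: mx_no_rows; rewrite sE -iN bin_small.
by have [c ->] := homog_deg0 Hw; exists c.
Qed.


Lemma lres_rank0 p : p != 0 -> \rank (lmx_at (h 0) p) = 1%N.
Proof. exact: (rank_point_col x_basis (lres_s0 hP) lres_span0). Qed.

Lemma lres_rank_last i p : i.+1 = N -> p != 0 -> \rank (lmx_at (h i) p) = 1%N.
Proof.
move=> iN p0; rewrite -mxrank_tr -lmx_at_tr.
apply: (rank_point_col (A := op A) x_basis) p0; first by rewrite sE -iN binn.
move=> k; have [c ec] := lres_span_last k iN.
by exists c^T; rewrite cst_op lmx_alg_op mulmx_op -ec; apply/matrixP=> ? ?; rewrite !mxE.
Qed.

Lemma lres_rank_gt i p : (N <= i)%N -> \rank (lmx_at (h i) p) = 0%N.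
Proof.
move=> Ni; apply/eqP; rewrite -leqn0; apply: leq_trans (rank_leq_row _) _.
by rewrite sE bin_small.
Qed.

(** Exactness on rows is the resolution and on columns the Gorenstein condition. The condition
    [0 < k] of [k3_col0] avoids the one surviving class of the dual complex. *)
Lemma lres_koszul3 : N = 3%N ->
  koszul3 (lmx_alg x (h 2)) (lmx_alg x (h 1)) (lmx_alg x (h 0)).
Proof.
move=> N3.
have D3 (w : 'cV[A]_(s 3)) : lmx_alg x (h 3) *m w = 0.
  by apply: mx_no_rows; rewrite sE N3.
split; try exact: homog_lmx.
- exact: lres_complex hP 1.
- exact: lres_complex hP 0.
- move=> k c Hc k0; apply: (gorenstein_exactS x1 hP gor _ Hc (D3 c)).
  by rewrite (gt_eqF k0) orbT.
- by move=> k c Hc Dc; apply: (gorenstein_exactS x1 hP gor) => //; rewrite N3.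
- by move=> k c Hc Dc; apply: (gorenstein_exactS x1 hP gor) => //; rewrite N3.
- by move=> k c Hc Dc; apply: (gorenstein_exact0 x1 hP gor _ Hc Dc); rewrite N3.
- by move=> k r Hr k0; apply: (lres_aug_homog x1 hP).
- by move=> k r Hr Dr; apply: (lres_exact_homog x1 hP).
- by move=> k r Hr Dr; apply: (lres_exact_homog x1 hP).
move=> k r Hr Dr; have [w _ ->] := lres_exact_homog x1 hP Hr Dr.
have -> : w = 0 by apply: trmx_inj; rewrite trmx0; apply: mx_no_rows; rewrite sE N3.
exact: mul0mx.
Qed.

Lemma lres_middle_rank3 p : N = 3%N -> degenerate (h 1) p -> \rank (lmx_at (h 1) p) = 2%N.
Proof.
move=> N3 [p0 rk]; have {}rk := leq_trans rk (eq_leq (etrans nN N3)).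
apply/eqP; rewrite eqn_leq -ltnS rk /=.
have [a [aP aH]] := hilb; rewrite N3 in aH.
apply: (koszul3_rank x_basis _ _ _ _ _ (hilbert_qpoly3 aH) noeth (lres_koszul3 N3) p0).
- by rewrite sE N3.
- by rewrite sE N3.
- by rewrite sE N3.
- by rewrite sE N3.
move=> k; have [b Hb] := aP k; apply: dim_eq_basis Hb; exact: deg_subspace.
Qed.

(** Partners of [p] on one side control [h 1]. Over [op A] the transposes of [h 3] and [h 2] take
    the places of [h 0] and [h 1], so partners on the other side control [h 2]; [up_ex] provides one
    when [h 1] drops rank. *)
Lemma lres_middle_rank4 p : N = 4%N -> unique_partners (zero_locus x) ->
  degenerate (h 1) p -> \rank (lmx_at (h 1) p) = 3%N /\ \rank (lmx_at (h 2) p) = 3%N.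
Proof.
move=> N4 up [p0 rk].
have [] := @partner_rank K A n x x_basis (s 2) (s 0) (s 1) (h 0) (h 1)
  (lres_s0 hP) _ lres_span0 (lres_complex hP 0) _ up p p0.
- by rewrite sE nN bin1.
- by move=> w Hw Dw; have [b Hb ->] := lres_exact_homog x1 hP Hw Dw; exists b.
have n4 : n = 4%N by rewrite nN N4.
move=> /proj2/(_ rk) Zp /(_ rk) rk1; have {rk1} [rk1] := etrans rk1 n4; split=> //.
have Zop : exists2 q, q != 0 & zero_locus (A := op A) x p q.
  by have [q q0 Z] := proj1 (up_ex up p0) Zp; exists q => //; apply/zero_locus_op.
have upop := unique_partners_op up.
have [] := @partner_rank K (op A) n x x_basis (s 2) (s 4) (s 3)
  (fun k => (h 3 k)^T) (fun k => (h 2 k)^T) _ _ _ _ _ upop p p0.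
- by rewrite sE N4.
- by rewrite sE nN N4.
- move=> k; have [|c ec] := @lres_span_last k 3; first by rewrite N4.
  by exists c^T; rewrite cst_op lmx_alg_op mulmx_op -ec; apply/matrixP=> ? ?; rewrite !mxE.
- by rewrite !lmx_alg_op mulmx_op (lres_complex hP 2) trmx0.
- move=> w Hw Dw; have [||w' Hw' ew] := gorenstein_exactS x1 hP gor _ (homog_opK Hw).
  + by rewrite orbT.
  + by apply/trmx_inj; rewrite trmx0 -mulmx_op -lmx_alg_op trmxK.
  by exists w'^T; [apply: homog_op | rewrite lmx_alg_op mulmx_op -ew trmxK].
move=> /proj1/(_ Zop) rk2 /(_ rk2) rk3; have [] := etrans rk3 n4.
by rewrite lmx_at_tr mxrank_tr.
Qed.

End LeftPointExact.

(** At a degenerate point the ranks are 1, 1 or 1, 2, 1 or 1, 3, 3, 1, followed by zeros; sums of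
    consecutive ones are the binomial coefficients of [N]. *)
Lemma qpoly_left_point_exact (K : fieldType) (A : cgAlg K) (n N : nat) (x : 'I_n -> A) :
  is_basis (@cg_deg K A 1) x -> noetherian A -> gorenstein A N -> hilbert_qpoly A N ->
  [\/ N = 2%N, N = 3%N | N = 4%N /\ unique_partners (zero_locus x)] ->
  forall i, left_point_exact x i.
Proof.
move=> xb noeth gor hilb NP i s h hP p deg_p; have [p0 _] := deg_p.
have sE := lres_rank (proj1 xb) hP hilb.
have r0 := lres_rank0 xb hP p0.
have rlast j := @lres_rank_last K A n N x xb gor hilb s h hP j p ^~ p0.
have rgt j := @lres_rank_gt K A n N x xb hilb s h hP j p.
rewrite [RHS]sE; case: NP => [N2|N3|[N4 up]]; subst N.
- case: i => [|[|i]]; [by rewrite r0 rlast | by rewrite rlast ?rgt |].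
  by rewrite !rgt // bin_small.
- have r1 := lres_middle_rank3 xb noeth gor hilb hP erefl deg_p.
  case: i => [|[|[|i]]]; [by rewrite r0 r1 | by rewrite r1 rlast | by rewrite rlast ?rgt |].
  by rewrite !rgt // bin_small.
have [r1 r2] := lres_middle_rank4 xb gor hilb hP erefl up deg_p.
case: i => [|[|[|[|i]]]]; [by rewrite r0 r1 | by rewrite r1 r2 | by rewrite r2 rlast | by rewrite rlast ?rgt |].
by rewrite !rgt // bin_small.
Qed.

(** * Right point-exactness through the opposite algebra *)

Lemma right_linear_resolution_op (K : fieldType) (A : cgAlg K) n (x : 'I_n -> A)
    (s : nat -> nat) (d : forall i, lin_mx K n (s i) (s i.+1)) :
  right_linear_resolution x d ->
  left_linear_resolution (A := op A) x (fun i k => (d i k)^T).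
Proof.
case=> s0 aug ex; split=> // [v|i v].
- have [H1 H2] := aug v^T; split=> [Hv|[w ->]].
    have [i j|w ew] := H1; first by rewrite mxE; apply: Hv.
    by exists w^T; rewrite lmx_alg_op mulmx_op -ew trmxK.
  move=> i j; rewrite lmx_alg_op -[w]trmxK mulmx_op mxE.
  have [_ H] := aug (lmx_alg x (d 0) *m w^T).
  by apply: H; exists w^T.
have [H1 H2] := ex i v^T; rewrite !lmx_alg_op; split=> [Hv|[w ev]].
  have [|w ew] := H1; last by exists w^T; rewrite mulmx_op -ew trmxK.
  by apply/trmx_inj; rewrite trmx0 -mulmx_op trmxK.
rewrite -[v]trmxK mulmx_op H2 ?trmx0 //; exists w^T.
by rewrite ev -mulmx_opK trmxK.
Qed.

Lemma qpoly_point_exact (K : fieldType) (A : cgAlg K) (n N : nat) (x : 'I_n -> A) :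
  is_basis (@cg_deg K A 1) x -> quantum_polynomial A N ->
  [\/ N = 2%N, N = 3%N | N = 4%N /\ unique_partners (zero_locus x)] ->
  point_exact x.
Proof.
move=> xb [noeth _ [gor gor_op] hilb] NP i; split; last first.
  exact: qpoly_left_point_exact xb noeth gor hilb NP i.
move=> s d /right_linear_resolution_op dP p [p0 rk].
have noeth_op : noetherian (op A) by case: noeth.
have NP' : [\/ N = 2%N, N = 3%N | N = 4%N /\ unique_partners (zero_locus (A := op A) x)].
  by case: NP => [?|?|[? /unique_partners_op ?]]; [constructor 1 | constructor 2 | constructor 3].
have := @qpoly_left_point_exact K (op A) n N x xb noeth_op gor_op hilb NP' i s _ dP p.
rewrite !lmx_at_tr !mxrank_tr; apply; split=> //.
by rewrite lmx_at_tr mxrank_tr.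
Qed.

Theorem proposition3p11 (K : closedFieldType) (charK0 : [pchar K] =i pred0)
    (A : cgAlg K) (n : nat) (x : 'I_n -> A) (x_basis : is_basis (@cg_deg K A 1) x) :
  (quantum_polynomial A 2 -> point_exact x) /\
  (quantum_polynomial A 3 -> point_exact x) /\
  (quantum_polynomial A 4 -> G1 x -> point_exact x).
Proof.
split=> [qp|]; first by apply: qpoly_point_exact x_basis qp _; constructor 1.
split=> [qp|qp /G1_unique_partners up]; apply: qpoly_point_exact x_basis qp _.
  by constructor 2.
by constructor 3.
Qed.
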